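(* Let $|\rho|<1$, $\mu\in\mathbb R$, $\sigma^2>0$, and let $(z_t)_{t\in\mathbb Z}$ be the stationary AR(1) process $z_t-\mu=\rho(z_{t-1}-\mu)+a_t$, where the $a_t$ are independent $N(0,\sigma^2)$ random variables. (a) (Zero mean case.) If $\mu=0$ and $\hat\rho$ is the Burg estimator of $\rho$ computed from $z_1,\dots,z_n$ with known mean zero, then $E(\hat\rho-\rho)=-\dfrac{2\rho}{n}+o\!\left(\dfrac1n\right)$ as $n\to\infty$. (b) (Unknown mean case.) If $\hat\rho$ is the Burg estimator of $\rho$ computed from $z_1,\dots,z_n$ with unknown mean, then $E(\hat\rho-\rho)=-\dfrac{1+3\rho}{n}+o\!\left(\dfrac1n\right)$ as $n\to\infty$.
   Context: The AR(1) process is the (causal) stationary solution, so $a_t$ is independent of $z_s$ for $s<t$. The Burg estimator for AR(1) with known mean zero is $$\hat\rho=\frac{2\sum_{t=2}^n z_tz_{t-1}}{\sum_{t=2}^n(z_t^2+z_{t-1}^2)}.$$ With unknown mean, it is the same formula with each $z_s$ replaced by $z_s-\overline z_n$, where $\overline z_n=\frac1n\sum_{t=1}^n z_t$. *)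

(* Defs.v *)
From mathcomp Require Export all_boot all_order all_algebra.
From mathcomp Require Export all_classical all_reals all_analysis.
Export Order.TTheory GRing.Theory Num.Theory.
Export numFieldNormedType.Exports.

Set Implicit Arguments.
Unset Strict Implicit.
Unset Printing Implicit Defensive.

Local Open Scope classical_set_scope.
Local Open Scope ring_scope.

Section burg.
Context {R : realType}.

(* A sample z_1, ..., z_n is read off a sequence x : nat -> R through its
   entries x 1, ..., x n; for n <= 1, or when all the observations vanish, the
   quotient below is 0 by the convention on division by zero. *)
Definition burg (n : nat) (x : nat -> R) : R :=
  (2 * \sum_(2 <= t < n.+1) x t * x t.-1) /
  \sum_(2 <= t < n.+1) (x t ^+ 2 + x t.-1 ^+ 2).

Definition sample_mean (n : nat) (x : nat -> R) : R :=
  (\sum_(1 <= t < n.+1) x t) / n%:R.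

Definition burg_unknown_mean (n : nat) (x : nat -> R) : R :=
  burg n (fun s => x s - sample_mean n x).

End burg.

Section processes.
Context d (T : measurableType d) (R : realType) (P : probability T R).

Definition mutually_independent (I : eqType) (X : I -> {RV P >-> R}) : Prop :=
  forall (J : seq I) (A : I -> set R), uniq J ->
    (forall i, measurable (A i)) ->
    P (\bigcap_(i in [set` J]) (X i @^-1` A i)) =
    (\prod_(i <- J) P (X i @^-1` A i))%E.

Definition random_vector (X : int -> {RV P >-> R}) (n : nat) (s : 'I_n -> int)
    (w : T) : n.-tuple R :=
  [tuple X (s i) w | i < n].

Definition strictly_stationary (X : int -> {RV P >-> R}) : Prop :=
  forall (n : nat) (s : 'I_n -> int) (h : int) (B : set (n.-tuple R)),
    measurable B ->
    P (random_vector X (fun i => s i + h) @^-1` B) =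
    P (random_vector X s @^-1` B).

(* Y is independent of the whole family (X_s)_{s < t}: its finite-dimensional
   cylinders form a pi-system generating the sigma-algebra of that family. *)
Definition independent_of_past (Y : {RV P >-> R}) (X : int -> {RV P >-> R})
    (t : int) : Prop :=
  forall (n : nat) (s : 'I_n -> int) (A : set R) (B : set (n.-tuple R)),
    (forall i, s i < t) -> measurable A -> measurable B ->
    P ((Y @^-1` A) `&` (random_vector X s @^-1` B)) =
    (P (Y @^-1` A) * P (random_vector X s @^-1` B))%E.

(* The second argument of normal_prob is the standard deviation; the density
   depends on it only through its square. *)
Definition gaussian_white_noise (sigma : R) (a : int -> {RV P >-> R}) : Prop :=
  mutually_independent a /\
  forall (t : int) (A : set R), measurable A ->
    distribution P (a t) A = normal_prob 0 sigma A.

Record stationary_AR1 (rho mu sigma : R) (z a : int -> {RV P >-> R}) : Prop := {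
  AR1_noise : gaussian_white_noise sigma a ;
  AR1_stationary : strictly_stationary z ;
  AR1_equation : forall t : int,
    {ae P, forall w, z t w - mu = rho * (z (t - 1) w - mu) + a t w} ;
  AR1_causal : forall t : int, independent_of_past (a t) z t }.

End processes.

(* The expectation is extended-real valued; stating the expansion in \bar R
   also says that it is finite for all large n. *)
Definition bias_expansion (d : measure_display) (T : measurableType d)
    (R : realType) (P : probability T R) (rhohat : nat -> T -> R)
    (rho c : R) : Prop :=
  exists2 e : nat -> R,
    e =o_\oo (fun n => n%:R^-1 : R) &
    \forall n \near \oo,
      ('E_P[fun w => (rhohat n w - rho)%R] = (c / n%:R + e n)%R%:E)%E.

(* Main.v *)
(** Write [x_i = z_(i+1) - mu], [e_i = x_(i+1) - rho x_i] for [i < N = n - 1] and let [N_n / D_n]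
    be the Burg quotient. The score [U = N_n - rho D_n] telescopes to
    [2 M + rho (x_0^2 - x_N^2)] with [M = \sum e_i x_i], and
    [(1 - rho^2) (D_n - E D_n) = (1 + rho^2) (x_0^2 - x_N^2) + 4 rho M + 2 \sum (e_i^2 - E e^2)].
    For the error [r = U / D_n] of the estimator, [m = E D_n] and [G = D_n - m], one has exactly
    [r = U / m - U G / m^2 + r G^2 / m^2]. Since [|r| <= 2], the identity [r = (U - r G) / m]
    bounds the last term by [(|U| G^2 + 2 |G|^3) / m^3], of mean [O(n^(-3/2))]: no inverse moment
    of [D_n] is needed. As [E U = 0], the leading term is [- E (U G) / m^2], and it only involves
    [E M^2 = N E e^2 E x^2] because [M] and [\sum (e_i^2 - E e^2)] are uncorrelated.
    Subtracting the sample mean adds the same quantity [k = O(1)] to numerator and denominator,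
    hence [(1 - rho) k] to [U], and [(1 - rho) E k / m] is equivalent to [- (1 + rho) / n].
    Gaussianity enters only through [E e = 0], [E e^2 > 0] and finite moments. *)

Require Import Defs.
From HB Require Import structures.
From mathcomp Require Import measurable_realfun normal_distribution ring lra.

Set Implicit Arguments.
Unset Strict Implicit.
Unset Printing Implicit Defensive.

Local Open Scope classical_set_scope.
Local Open Scope ring_scope.

(** * Random variables with finite moments *)

Section finite_moments.
Context d (T : measurableType d) (R : realType) (P : probability T R).
Implicit Types f g : T -> R.

Definition mean f : R := \int[P]_w f w.

(** Finiteness of all moments is closed under the ring operations, so [fmom_tac] settles
    integrability side conditions by following the shape of the function. *)
Definition fmom f := forall p : nat, P.-integrable setT (fun w => (f w ^+ p)%:E).

Lemma fmom_integrable f : fmom f -> P.-integrable setT (EFin \o f).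
Proof. by move=> /(_ 1). Qed.

Lemma fmom_measurable f : fmom f -> measurable_fun setT f.
Proof. by move/fmom_integrable/measurable_int/measurable_EFinP. Qed.

Lemma integrable_dominated f g : measurable_fun setT f ->
  P.-integrable setT (EFin \o g) -> (forall w, `|f w| <= g w) ->
  P.-integrable setT (EFin \o f).
Proof.
move=> mf ig fg; apply: (le_integrable measurableT _ _ ig).
  exact/measurable_EFinP.
by move=> w _ /=; rewrite lee_fin (le_trans (fg w))// ler_norm.
Qed.

Lemma fmom_cst c : fmom (fun=> c).
Proof. by move=> p; exact: finite_measure_integrable_cst. Qed.

Lemma fmomX f k : fmom f -> fmom (fun w => f w ^+ k).
Proof.
move=> ff p; rewrite [X in P.-integrable _ X](_ : _ = fun w => (f w ^+ (k * p))%:E) //.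
by apply/funext => w; rewrite exprM.
Qed.

Lemma norm_expM_le (a b : R) p : `|(a * b) ^+ p| <= a ^+ (2 * p) + b ^+ (2 * p).
Proof.
rewrite exprMn normrM !exprM -!(exprM _ 2 p) !(mulnC 2 p) !exprM.
rewrite -(real_normK (num_real (a ^+ p))) -(real_normK (num_real (b ^+ p))).
have := sqr_ge0 (`|a ^+ p| - `|b ^+ p|).
have := normr_ge0 (a ^+ p); have := normr_ge0 (b ^+ p).
by move: `|a ^+ p| `|b ^+ p| => u v ? ? ?; nra.
Qed.

Lemma fmomM f g : fmom f -> fmom g -> fmom (fun w => f w * g w).
Proof.
move=> ff fg p.
apply: (@integrable_dominated _ (fun w => f w ^+ (2 * p) + g w ^+ (2 * p))).
- apply: measurable_funX; apply: measurable_funM; exact: fmom_measurable.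
- have := integrableD measurableT (ff (2 * p)%N) (fg (2 * p)%N).
  by apply: eq_integrable.
- by move=> w; exact: norm_expM_le.
Qed.

Lemma norm_expD_le (a b : R) p : `|(a + b) ^+ p| <= 2 ^+ p * (`|a ^+ p| + `|b ^+ p|).
Proof.
rewrite normrX (@le_trans _ _ ((`|a| + `|b|) ^+ p))//.
  by rewrite lerXn2r ?nnegrE// ?addr_ge0// ler_normD.
rewrite !normrX; move: (normr_ge0 a) (normr_ge0 b); move: `|a| `|b| => {a b} u v u0 v0.
wlog uv : u v u0 v0 / u <= v => [h|].
  have [/h|/ltW/h] := leP u v; first exact.
  by rewrite addrC [X in _ -> _ -> _ <= _ * X]addrC; exact.
apply: (@le_trans _ _ ((2 * v) ^+ p)).
  by rewrite lerXn2r ?nnegrE// ?addr_ge0// ?mulr_ge0//; lra.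
by rewrite exprMn ler_wpM2l ?exprn_ge0// lerDr exprn_ge0.
Qed.

Lemma fmomD f g : fmom f -> fmom g -> fmom (fun w => f w + g w).
Proof.
move=> ff fg p.
apply: (@integrable_dominated _ (fun w => 2 ^+ p * (`|f w ^+ p| + `|g w ^+ p|))).
- apply: measurable_funX; apply: measurable_funD; exact: fmom_measurable.
- have := integrableZl measurableT (2 ^+ p) (integrableD measurableT
    (integrable_norm (ff p)) (integrable_norm (fg p))).
  by apply: eq_integrable.
- by move=> w; exact: norm_expD_le.
Qed.

Lemma fmomZ c f : fmom f -> fmom (fun w => c * f w).
Proof. by move=> ff; apply: fmomM ff; exact: fmom_cst. Qed.

Lemma fmomN f : fmom f -> fmom (fun w => - f w).
Proof.
move=> /(fmomZ (-1)); congr fmom; apply/funext => w; exact: mulN1r.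
Qed.

Lemma fmomB f g : fmom f -> fmom g -> fmom (fun w => f w - g w).
Proof. by move=> ff /fmomN; exact: fmomD. Qed.

Lemma fmom_norm f : fmom f -> fmom (fun w => `|f w|).
Proof.
move=> ff p; have := integrable_norm (ff p).
by apply: eq_integrable => // w _ /=; rewrite normrX.
Qed.

Lemma fmom_sum (I : Type) (s : seq I) (Q : pred I) (F : I -> T -> R) :
  (forall i, Q i -> fmom (F i)) -> fmom (fun w => \sum_(i <- s | Q i) F i w).
Proof.
move=> FF; elim: s => [|i s IH].
  rewrite (_ : (fun=> _) = fun=> 0); first exact: fmom_cst.
  by apply/funext => w; rewrite big_nil.
have [Qi|nQi] := boolP (Q i); last first.
  by under eq_fun do rewrite big_cons (negbTE nQi).
by under eq_fun do rewrite big_cons Qi; apply: fmomD => //; exact: FF.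
Qed.

Lemma fmom_dominated f g : measurable_fun setT f -> fmom g ->
  (forall w, `|f w| <= g w) -> fmom f.
Proof.
move=> mf fg h p.
apply: (@integrable_dominated _ (fun w => g w ^+ p)).
- exact: measurable_funX.
- exact: fg.
by move=> w; rewrite normrX lerXn2r ?nnegrE ?h// (le_trans _ (h w)).
Qed.

Lemma mean_cst c : mean (fun=> c) = c.
Proof. by have := expectation_cst P c; rewrite unlock /mean /Rintegral => ->. Qed.

Lemma meanD f g : fmom f -> fmom g -> mean (fun w => f w + g w) = mean f + mean g.
Proof. by move=> /fmom_integrable ff /fmom_integrable fg; rewrite /mean RintegralD. Qed.

Lemma meanZ c f : fmom f -> mean (fun w => c * f w) = c * mean f.
Proof. by move=> /fmom_integrable ff; rewrite /mean RintegralZl. Qed.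

Lemma meanN f : fmom f -> mean (fun w => - f w) = - mean f.
Proof.
move=> ff; rewrite -mulN1r -meanZ//; congr mean; apply/funext => w.
by rewrite mulN1r.
Qed.

Lemma meanB f g : fmom f -> fmom g -> mean (fun w => f w - g w) = mean f - mean g.
Proof. by move=> ff fg; rewrite meanD ?meanN//; exact: fmomN. Qed.

Lemma le_mean f g : fmom f -> fmom g -> (forall w, f w <= g w) -> mean f <= mean g.
Proof.
by move=> /fmom_integrable ff /fmom_integrable fg fg'; apply: le_Rintegral.
Qed.

Lemma mean_ge0 f : (forall w, 0 <= f w) -> 0 <= mean f.
Proof. by move=> f0; apply: Rintegral_ge0. Qed.

Lemma norm_mean_le f g : fmom f -> fmom g -> (forall w, `|f w| <= g w) ->
  `|mean f| <= mean g.
Proof.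
move=> ff fg h; apply: (le_trans (le_normr_Rintegral measurableT _)).
  exact: fmom_integrable.
by apply: le_mean h => //; exact: fmom_norm.
Qed.

Lemma ae_eq_mean f g : measurable_fun setT f -> measurable_fun setT g ->
  {ae P, forall w, f w = g w} -> mean f = mean g.
Proof.
move=> mf mg fg; rewrite /mean /Rintegral; congr fine.
apply: ae_eq_integral => //; [exact/measurable_EFinP|exact/measurable_EFinP|].
by apply: filterS fg => w -> .
Qed.

End finite_moments.

Ltac fmom_tac := repeat first [ assumption | apply: fmom_cst | apply: fmomB
  | apply: fmomD | apply: fmomM | apply: fmomN | apply: fmomX | apply: fmom_norm ].

(** * Fourth-moment orders of magnitude *)

Section fourth_moments.
Context d (T : measurableType d) (R : realType) (P : probability T R).
Implicit Types (f g : T -> R) (r : nat -> R) (X Y Z xi : nat -> T -> R).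

Definition psum xi k : T -> R := fun w => \sum_(i < k) xi i w.

Lemma psum0 xi w : psum xi 0 w = 0.
Proof. by rewrite /psum big_ord0. Qed.

Lemma psumS xi k w : psum xi k.+1 w = psum xi k w + xi k w.
Proof. by rewrite /psum big_ord_recr. Qed.

Lemma fmom_psum xi k : (forall i, fmom P (xi i)) -> fmom P (psum xi k).
Proof. by move=> h; apply: fmom_sum. Qed.

(** The term [4 a^3 b] stays exact because its mean vanishes for martingales; the rest
    [6 a^2 b^2 + 4 a b^3] is absorbed with a free weight [t]. *)
Lemma expr4D_le (a b t : R) : 0 < t ->
  (a + b) ^+ 4 <= (1 + t^-1) * a ^+ 4 + 4 * (a ^+ 3 * b) + (16 * t + 3) * b ^+ 4.
Proof.
move=> t0; rewrite -subr_ge0.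
have -> : (1 + t^-1) * a ^+ 4 + 4 * (a ^+ 3 * b) + (16 * t + 3) * b ^+ 4
    - (a + b) ^+ 4 = (a ^+ 2 - 4 * t * b ^+ 2) ^+ 2 / t + 2 * (b * (a - b)) ^+ 2.
  by field; rewrite gt_eqF.
apply: addr_ge0; last by rewrite mulr_ge0 ?sqr_ge0.
by apply: mulr_ge0; [exact: sqr_ge0 | rewrite invr_ge0 ltW].
Qed.

(** Each increment is orthogonal to the cube of the preceding sum, so [expr4D_le] yields the
    recursion [v' <= (1 + 1/t) v + (16 t + 3) K]. With [t = k + 1] it preserves the bound
    [19 K k^2]; the constant [19 = 16 + 3] is what the first step, [t = 1], requires. *)
Lemma martingale_fourth_moment xi N (K : R) : 0 <= K ->
  (forall i, fmom P (xi i)) ->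
  (forall k, (k < N)%N -> mean P (fun w => psum xi k w ^+ 3 * xi k w) = 0) ->
  (forall k, (k < N)%N -> mean P (fun w => xi k w ^+ 4) <= K) ->
  mean P (fun w => psum xi N w ^+ 4) <= 19 * K * N%:R ^+ 2.
Proof.
move=> K0 xi_fm orth xi4.
suff h k : (k <= N)%N -> mean P (fun w => psum xi k w ^+ 4) <= 19 * K * k%:R ^+ 2.
  exact: h.
elim: k => [_|k IH kN].
  rewrite (_ : (fun w => _) = fun=> 0); last first.
    by apply/funext => w; rewrite psum0 expr0n.
  by rewrite mean_cst expr0n mulr0.
have Sfm := @fmom_psum xi k xi_fm; have xifm := xi_fm k.
have [t tE] : {t : R | t = k.+1%:R} by exists k.+1%:R.
have t0 : 0 < t by rewrite tE.
apply: (@le_trans _ _ (mean P (fun w => (1 + t^-1) * psum xi k w ^+ 4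
   + 4 * (psum xi k w ^+ 3 * xi k w) + (16 * t + 3) * xi k w ^+ 4))).
  apply: le_mean.
  - by apply: fmomX; apply: fmom_psum.
  - by fmom_tac.
  - by move=> w; rewrite psumS expr4D_le.
rewrite !meanD ?meanZ//; try by fmom_tac.
rewrite orth// mulr0 addr0.
have {IH} := IH (ltnW kN); have := xi4 _ kN.
set m := mean _ _; set v := mean _ _ => mK vK.
have t1 : 1 <= t by rewrite tE ler1n.
have kt : k%:R = t - 1 :> R by rewrite tE -natr1; ring.
rewrite kt in vK.
have ti : t^-1 * t = 1 by rewrite mulVf// gt_eqF.
have ti0 : 0 < t^-1 by rewrite invr_gt0.
have step1 : (1 + t^-1) * v <= (1 + t^-1) * (19 * K * (t - 1) ^+ 2).
  by rewrite ler_wpM2l//; lra.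
have step2 : (16 * t + 3) * m <= (16 * t + 3) * K by rewrite ler_wpM2l//; lra.
apply: (le_trans (lerD step1 step2)).
have -> : (1 + t^-1) * (19 * K * (t - 1) ^+ 2) =
   19 * K * ((t - 1) ^+ 2 + (t - 2 + t^-1)).
  have -> : (t - 2 + t^-1) = t^-1 * (t - 1) ^+ 2.
    rewrite (_ : t^-1 * (t - 1) ^+ 2 = (t^-1 * t) * (t - 2) + t^-1); last by ring.
    by rewrite ti mul1r.
  by ring.
have ti1 : t^-1 <= 1 by rewrite invf_le1//; lra.
rewrite -tE.
rewrite -subr_ge0 (_ : _ - _ = K * (19 * (1 - t^-1) + 3 * (t - 1))); last by ring.
by rewrite mulr_ge0//; lra.
Qed.

(** An [L^4] form of [Y_N = O(r_N)]; fourth moments suffice for the products of two and of three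
    factors met below. Index 0 is excluded because rates such as [rt] and [N%:R] vanish there. *)
Definition O4 r Y := (forall N, fmom P (Y N)) /\
  exists C, forall N, (0 < N)%N -> mean P (fun w => Y N w ^+ 4) <= C * r N ^+ 4.

Lemma exprD4_le (a b : R) : (a + b) ^+ 4 <= 8 * (a ^+ 4 + b ^+ 4).
Proof.
rewrite -subr_ge0 (_ : _ - _ =
  (a - b) ^+ 2 * (5 * (a + b) ^+ 2 + 2 * a ^+ 2 + 2 * b ^+ 2)); last by ring.
apply: mulr_ge0; first exact: sqr_ge0.
by move: (sqr_ge0 a) (sqr_ge0 b) (sqr_ge0 (a + b)); lra.
Qed.

Lemma O4D r Y Z : O4 r Y -> O4 r Z -> O4 r (fun N w => Y N w + Z N w).
Proof.
move=> [Yf [C hC]] [Zf [D hD]]; split=> [N|]; first by fmom_tac.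
exists (8 * (C + D)) => N N0.
have YN := Yf N; have ZN := Zf N.
apply: (@le_trans _ _ (mean P (fun w => 8 * (Y N w ^+ 4 + Z N w ^+ 4)))).
  by apply: le_mean => [||w]; [fmom_tac|fmom_tac|exact: exprD4_le].
rewrite meanZ; last by fmom_tac.
rewrite meanD; [|by fmom_tac|by fmom_tac].
have := hC _ N0; have := hD _ N0; set u := mean _ _; set v := mean _ _.
by lra.
Qed.

Lemma O4Z c r Y : O4 r Y -> O4 r (fun N w => c * Y N w).
Proof.
move=> [Yf [C hC]]; split=> [N|]; first by fmom_tac.
exists (c ^+ 4 * C) => N N0; have YN := Yf N.
under eq_fun do rewrite exprMn.
rewrite meanZ; last by fmom_tac.
by rewrite -mulrA ler_wpM2l ?hC// exprn_even_ge0.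
Qed.

Lemma O4_mono r r' Y : (forall N, (0 < N)%N -> 0 <= r N <= r' N) ->
  O4 r Y -> O4 r' Y.
Proof.
move=> rr' [Yf [C hC]]; split=> //; exists `|C| => N N0.
apply: (le_trans (hC _ N0)); apply: (@le_trans _ _ (`|C| * r N ^+ 4)).
  have /andP[r0 _] := rr' _ N0.
  by rewrite ler_wpM2r ?exprn_ge0// ler_norm.
have /andP[r0 rr] := rr' _ N0.
by rewrite ler_wpM2l// lerXn2r// nnegrE// (le_trans r0).
Qed.

Lemma O4_le r Y Z : (forall N, fmom P (Z N)) ->
  (forall N, (0 < N)%N -> forall w, `|Z N w| <= `|Y N w|) -> O4 r Y -> O4 r Z.
Proof.
move=> Zf ZY [Yf [C hC]]; split=> //; exists C => N N0.
have YN := Yf N; have ZN := Zf N.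
apply: (le_trans _ (hC _ N0)); apply: le_mean => [||w]; [by fmom_tac|by fmom_tac|].
rewrite -[X in X <= _]ger0_norm ?exprn_even_ge0//.
rewrite -[X in _ <= X]ger0_norm ?exprn_even_ge0//.
by rewrite !normrX lerXn2r ?nnegrE// ZY.
Qed.

Lemma O4_scale r s Y : (forall N, (0 < N)%N -> 0 < s N) ->
  O4 (fun N => s N * r N) Y -> O4 r (fun N w => (s N)^-1 * Y N w).
Proof.
move=> s0 [Yf [C hC]]; split=> [N|]; first by fmom_tac.
exists C => N N0; have YN := Yf N.
under eq_fun do rewrite exprMn.
rewrite meanZ; last by fmom_tac.
rewrite exprVn ler_pdivrMl ?exprn_gt0 ?s0//.
by rewrite mulrCA -exprMn hC.
Qed.

Lemma prod_le_fourth (a b : R) : `|a * b| <= 1 + a ^+ 4 + b ^+ 4.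
Proof.
rewrite -[a ^+ 4]/(a ^+ (2 * 2)) -[b ^+ 4]/(b ^+ (2 * 2)) !exprM normrM.
rewrite -(real_normK (num_real a)) -(real_normK (num_real b)).
move: `|a| `|b| => u v.
have := sqr_ge0 (u - v); have := sqr_ge0 (u ^+ 2 - 1).
have := sqr_ge0 (u ^+ 2); have := sqr_ge0 (v ^+ 2).
by have := sqr_ge0 (v ^+ 2 - 1); lra.
Qed.

(** Dividing each factor by its rate reduces the claim to [prod_le_fourth], whose constant 1 is then
    harmless; this stands in for the Cauchy-Schwarz inequality. *)
Lemma O4_mean_prod r s Y Z : (forall N, (0 < N)%N -> 0 < r N) ->
  (forall N, (0 < N)%N -> 0 < s N) -> O4 r Y -> O4 s Z ->
  exists C, forall N, (0 < N)%N ->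
    `|mean P (fun w => Y N w * Z N w)| <= C * (r N * s N).
Proof.
move=> r0 s0 [Yf [C hC]] [Zf [D hD]]; exists (1 + C + D) => N N0.
have YN := Yf N; have ZN := Zf N.
have {}r0 := r0 _ N0; have {}s0 := s0 _ N0.
pose u : R := (r N)^-1; pose v : R := (s N)^-1.
have uv0 : 0 < u * v by rewrite mulr_gt0 ?invr_gt0.
suff : u * v * `|mean P (fun w => Y N w * Z N w)| <= 1 + C + D.
  move=> h; rewrite mulrC -ler_pdivrMl ?mulr_gt0//.
  by rewrite invfM.
rewrite -[u * v]gtr0_norm// -normrM -meanZ; last by fmom_tac.
apply: (@le_trans _ _ (mean P (fun w => 1 + u ^+ 4 * Y N w ^+ 4 + v ^+ 4 * Z N w ^+ 4))).
  apply: norm_mean_le => [||w]; [by fmom_tac|by fmom_tac|].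
  rewrite -!exprMn (le_trans _ (prod_le_fourth _ _))//.
  by rewrite mulrACA.
rewrite !meanD ?meanZ ?mean_cst; try by fmom_tac.
apply: lerD; first apply: lerD => //.
  by rewrite /u exprVn ler_pdivrMl ?exprn_gt0// mulrC hC.
by rewrite /v exprVn ler_pdivrMl ?exprn_gt0// mulrC hD.
Qed.

End fourth_moments.

(** * Moments of an AR(1) sequence *)

Section AR1_moments.
Context d (T : measurableType d) (R : realType) (P : probability T R).
Implicit Types (f g : T -> R) (x : nat -> T -> R) (rho : R).

(* Independence is only ever applied to polynomials in the past. *)
Inductive poly_past x (i : nat) : (T -> R) -> Prop :=
| past_var j of (j <= i)%N : poly_past x i (x j)
| past_cst c : poly_past x i (fun=> c)
| pastD f g of poly_past x i f & poly_past x i g :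
    poly_past x i (fun w => f w + g w)
| pastM f g of poly_past x i f & poly_past x i g :
    poly_past x i (fun w => f w * g w).

Lemma pastX x i f p : poly_past x i f -> poly_past x i (fun w => f w ^+ p).
Proof.
move=> fp; elim: p => [|p IH]; first exact: past_cst.
rewrite (_ : (fun w => _) = fun w => f w * f w ^+ p); first exact: pastM.
by apply/funext => w; rewrite exprS.
Qed.

Lemma pastB x i f g : poly_past x i f -> poly_past x i g ->
  poly_past x i (fun w => f w - g w).
Proof.
move=> fp gp; rewrite (_ : (fun w => _) = fun w => f w + -1 * g w).
  by apply: pastD => //; apply: pastM => //; exact: past_cst.
by apply/funext => w; rewrite mulN1r.
Qed.

Lemma past_psum x i (xi : nat -> T -> R) k :
  (forall j, (j < k)%N -> poly_past x i (xi j)) -> poly_past x i (psum xi k).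
Proof.
elim: k => [_|k IH h].
  rewrite (_ : psum xi 0 = fun=> 0); first exact: past_cst.
  by apply/funext => w; rewrite psum0.
rewrite (_ : psum xi k.+1 = fun w => psum xi k w + xi k w); last first.
  by apply/funext => w; rewrite psumS.
by apply: pastD; [apply: IH => j jk; apply: h; exact: ltnW | exact: h].
Qed.

Definition innov rho x i : T -> R := fun w => x i.+1 w - rho * x i w.

(** The interface between the process and the expansion: marginal moments are constant in time, and
    powers of an innovation factor out of means against polynomials in the past. *)
Record AR1_moments rho (s2 : R) x : Prop := {
  AR1m_fmom : forall i, fmom P (x i) ;
  AR1m_stat : forall i p,
    mean P (fun w => x i w ^+ p) = mean P (fun w => x 0 w ^+ p) ;
  AR1m_mean : forall i, mean P (innov rho x i) = 0 ;
  AR1m_var : forall i, mean P (fun w => innov rho x i w ^+ 2) = s2 ;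
  AR1m_indep : forall i p Y, poly_past x i Y -> fmom P Y ->
    mean P (fun w => innov rho x i w ^+ p * Y w) =
    mean P (fun w => innov rho x i w ^+ p) * mean P Y }.

End AR1_moments.

Ltac past_tac := repeat first [ assumption | apply: past_cst | apply: pastB
  | apply: pastD | apply: pastM | apply: pastX | by apply: past_var ].

(** * Moments of the martingales built from the innovations *)

Section AR1_moment_bounds.
Context d (T : measurableType d) (R : realType) (P : probability T R).
Context (rho s2 : R) (x : nat -> T -> R).
Context (hrho : `|rho| < 1) (hx : AR1_moments P rho s2 x).

Local Notation e := (innov rho x).
Local Notation E := (mean P).

Lemma fmom_x i : fmom P (x i). Proof. exact: AR1m_fmom hx i. Qed.

Lemma fmom_innov i : fmom P (e i).
Proof. by rewrite /innov; have := fmom_x i; have := fmom_x i.+1 => ? ?; fmom_tac. Qed.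

Lemma subr_rho_gt0 : 0 < 1 - rho.
Proof. by rewrite subr_gt0 (le_lt_trans (ler_norm _)). Qed.

Lemma addr_rho_gt0 : 0 < 1 + rho.
Proof. by have := hrho; rewrite ltr_norml => /andP[]; lra. Qed.

Lemma subr_rho2_gt0 : 0 < 1 - rho ^+ 2.
Proof.
rewrite (_ : _ - _ = (1 - rho) * (1 + rho)); last by ring.
by rewrite mulr_gt0 ?subr_rho_gt0 ?addr_rho_gt0.
Qed.

(** The stationary variance of the sequence, as [mean_x2] shows. *)
Definition ar_var := s2 / (1 - rho ^+ 2).

Lemma orth1 i Y : poly_past x i Y -> fmom P Y -> E (fun w => e i w * Y w) = 0.
Proof.
move=> Yp Yf; have := AR1m_indep hx 1 Yp Yf.
by rewrite [E (fun w => e i w ^+ 1)](AR1m_mean hx) mul0r.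
Qed.

Lemma orth2 i Y : poly_past x i Y -> fmom P Y ->
  E (fun w => e i w ^+ 2 * Y w) = s2 * E Y.
Proof. by move=> Yp Yf; rewrite (AR1m_indep hx)// (AR1m_var hx). Qed.

(** Taking means in the recursion, stationarity gives [(1 - rho) E x = 0]. *)
Lemma mean_x i : E (x i) = 0.
Proof.
have st k : E (x k) = E (x 0) := AR1m_stat hx k 1.
rewrite st; have /esym := AR1m_mean hx 0.
have x0 := fmom_x 0; have x1 := fmom_x 1.
rewrite /innov meanB ?meanZ//; last by fmom_tac.
rewrite st -{1}[E (x 0)]mul1r -mulrBl => /eqP.
by rewrite eq_sym mulf_eq0 gt_eqF ?subr_rho_gt0//= => /eqP.
Qed.

(** When the recursion is squared, the cross term vanishes by orthogonality and stationarity leaves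
    [v = s2 + rho^2 v]. *)
Lemma mean_x2 i : E (fun w => x i w ^+ 2) = ar_var.
Proof.
rewrite (AR1m_stat hx).
have x0 := fmom_x 0; have e0 := fmom_innov 0.
have := AR1m_stat hx 1 2.
rewrite (_ : (fun w => x 1 w ^+ 2) = fun w =>
  e 0 w ^+ 2 + (2 * rho) * (e 0 w * x 0 w) + rho ^+ 2 * x 0 w ^+ 2); last first.
  by apply/funext => w; rewrite /innov; ring.
rewrite !meanD ?meanZ; try by fmom_tac.
rewrite (AR1m_var hx) orth1//; last by past_tac.
move=> h; rewrite /ar_var; apply: (mulIf (lt0r_neq0 subr_rho2_gt0)).
rewrite mulfVK ?lt0r_neq0 ?subr_rho2_gt0//.
by move: h; set v := mean _ _; lra.
Qed.

(** [AR1_moments] fixes only the first two moments of the innovations; higher ones are bounded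
    uniformly through [e_i = x_(i+1) - rho x_i] and the stationarity of [x]. *)
Lemma fmom_moment_bound p : exists2 C, 0 <= C &
  forall i, E (fun w => e i w ^+ (2 * p)) <= C.
Proof.
pose c := (2 ^+ (2 * p) : R).
exists (c * (1 + rho ^+ (2 * p)) * E (fun w => x 0 w ^+ (2 * p))).
  rewrite mulr_ge0//; last by apply: mean_ge0 => w; rewrite exprM exprn_ge0 ?sqr_ge0.
  by rewrite mulr_ge0 ?exprn_ge0// addr_ge0// exprM exprn_ge0 ?sqr_ge0.
move=> i; have xi := fmom_x i; have xi1 := fmom_x i.+1; have ei := fmom_innov i.
apply: (@le_trans _ _ (E (fun w => c * (x i.+1 w ^+ (2 * p)
    + rho ^+ (2 * p) * x i w ^+ (2 * p))))).
  apply: le_mean => [||w]; [by fmom_tac|by fmom_tac|].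
  have ev (u : R) : `|u ^+ (2 * p)| = u ^+ (2 * p).
    by rewrite ger0_norm// exprM exprn_ge0 ?sqr_ge0.
  have := norm_expD_le (x i.+1 w) (- (rho * x i w)) (2 * p).
  by rewrite !ev -/c [(- _) ^+ (2 * p)]exprM sqrrN -exprM exprMn.
rewrite meanZ; last by fmom_tac.
rewrite meanD; [|by fmom_tac|by fmom_tac].
rewrite meanZ; last by fmom_tac.
rewrite !(AR1m_stat hx _ (2 * p)).
by rewrite -mulrA mulrDl mul1r.
Qed.

Definition Mxi i : T -> R := fun w => e i w * x i w.
Definition Qxi i : T -> R := fun w => e i w ^+ 2 - s2.
(* Increments of the martingale [A_k ^ 2 - k s2], whose fourth moment controls the eighth
   moment of [A_k]. *)
Definition Bxi i : T -> R := fun w => 2 * (psum e i w * e i w) + (e i w ^+ 2 - s2).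

Local Notation M := (psum Mxi).
Local Notation Q := (psum Qxi).
Local Notation A := (psum e).

Lemma past_innov i j : (j < i)%N -> poly_past x i (e j).
Proof. by move=> ji; rewrite /innov; past_tac; apply: past_var => //; exact: ltnW. Qed.

Lemma past_x i j : (j <= i)%N -> poly_past x i (x j).
Proof. exact: past_var. Qed.

Lemma past_M k : poly_past x k (M k).
Proof.
apply: past_psum => j jk; have := past_innov jk; have := past_x (ltnW jk).
by rewrite /Mxi => ? ?; past_tac.
Qed.

Lemma past_Q k : poly_past x k (Q k).
Proof. by apply: past_psum => j /past_innov; rewrite /Qxi => ?; past_tac. Qed.

Lemma past_A k : poly_past x k (A k).
Proof. by apply: past_psum => j; exact: past_innov. Qed.

Lemma past_A_le k j : (j <= k)%N -> poly_past x k (A j).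
Proof. by move=> jk; apply: past_psum => i ij; apply: past_innov; exact: leq_trans jk. Qed.

Lemma past_B k : poly_past x k (psum Bxi k).
Proof.
apply: past_psum => j jk; have := past_innov jk; have := past_A_le (ltnW jk).
by rewrite /Bxi => ? ?; past_tac.
Qed.

Lemma fmom_Mxi i : fmom P (Mxi i).
Proof. by rewrite /Mxi; have := fmom_innov i; have := fmom_x i => ? ?; fmom_tac. Qed.

Lemma fmom_Qxi i : fmom P (Qxi i).
Proof. by rewrite /Qxi; have := fmom_innov i => ?; fmom_tac. Qed.

Lemma fmom_M k : fmom P (M k). Proof. by apply: fmom_psum; exact: fmom_Mxi. Qed.
Lemma fmom_Q k : fmom P (Q k). Proof. by apply: fmom_psum; exact: fmom_Qxi. Qed.
Lemma fmom_A k : fmom P (A k). Proof. by apply: fmom_psum; exact: fmom_innov. Qed.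

Lemma fmom_Bxi i : fmom P (Bxi i).
Proof. by rewrite /Bxi; have := fmom_innov i; have := fmom_A i => ? ?; fmom_tac. Qed.

Lemma fmom_B k : fmom P (psum Bxi k). Proof. by apply: fmom_psum; exact: fmom_Bxi. Qed.

Definition rt (N : nat) : R := Num.sqrt N%:R.

Lemma rt_gt0 N : (0 < N)%N -> 0 < rt N.
Proof. by move=> N0; rewrite sqrtr_gt0 ltr0n. Qed.

Lemma rt2 N : rt N ^+ 2 = N%:R.
Proof. by rewrite sqr_sqrtr. Qed.

Lemma rt4 N : rt N ^+ 4 = N%:R ^+ 2.
Proof. by rewrite -rt2 -exprM. Qed.

Lemma rt_ge1 N : (0 < N)%N -> 1 <= rt N.
Proof. by move=> N0; rewrite -[leLHS]sqrtr1 ler_wsqrtr// ler1n. Qed.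

(** The innovation [e k] is independent of [M k ^ 3 * x k], which kills the cubic cross term;
    independence also splits the fourth moment of the increment. *)
Lemma O4_M : O4 P rt M.
Proof.
split; first exact: fmom_M.
have [C C0 hC] := fmom_moment_bound 2.
pose K := C * E (fun w => x 0 w ^+ 4).
have K0 : 0 <= K by rewrite mulr_ge0// mean_ge0// => w; rewrite exprn_even_ge0.
exists (19 * K) => N N0; rewrite rt4; apply: martingale_fourth_moment => //.
- exact: fmom_Mxi.
- move=> k _; have := past_M k; have := @past_x k k (leqnn k) => xp Mp.
  have Mf := fmom_M k; have xf := fmom_x k.
  rewrite (_ : (fun w => _) = fun w => e k w * (M k w ^+ 3 * x k w)).
    by apply: orth1; [past_tac|fmom_tac].
  by apply/funext => w; rewrite /Mxi; ring.
- move=> k _; have xf := fmom_x k; have xp := @past_x k k (leqnn k).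
  under eq_fun do rewrite /Mxi exprMn.
  rewrite (AR1m_indep hx); [|by past_tac|by fmom_tac].
  rewrite (AR1m_stat hx) ler_wpM2r//.
  by rewrite mean_ge0// => w; rewrite exprn_even_ge0.
Qed.

Lemma Qxi_fourth : exists2 K, 0 <= K & forall i, E (fun w => Qxi i w ^+ 4) <= K.
Proof.
have [C C0 hC] := fmom_moment_bound 4.
exists (8 * (C + s2 ^+ 4)).
  by rewrite mulr_ge0// addr_ge0// exprn_even_ge0.
move=> i; have ei := fmom_innov i.
apply: (@le_trans _ _ (E (fun w => 8 * (e i w ^+ 8 + s2 ^+ 4)))).
  apply: le_mean => [||w]; [by have := fmom_Qxi i => ?; fmom_tac|by fmom_tac|].
  have := exprD4_le (e i w ^+ 2) (- s2).
  by rewrite -exprM (_ : (- s2) ^+ 4 = s2 ^+ 4); last by ring.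
rewrite meanZ; last by fmom_tac.
rewrite meanD ?mean_cst; [|by fmom_tac|by fmom_tac].
by rewrite ler_wpM2l// lerD2r; exact: hC.
Qed.

Lemma O4_Q : O4 P rt Q.
Proof.
split; first exact: fmom_Q.
have [K K0 hK] := Qxi_fourth.
exists (19 * K) => N N0; rewrite rt4; apply: martingale_fourth_moment => //.
- exact: fmom_Qxi.
- move=> k _; have Qp := past_Q k; have Qf := fmom_Q k; have ek := fmom_innov k.
  rewrite (_ : (fun w => _) = fun w => e k w ^+ 2 * (Q k w ^+ 3) - s2 * Q k w ^+ 3).
    rewrite meanB ?meanZ ?orth2 ?subrr//; by [past_tac|fmom_tac].
  by apply/funext => w; rewrite /Qxi; ring.
Qed.

Lemma O4_A : O4 P rt A.
Proof.
split; first exact: fmom_A.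
have [K K0 hK] := fmom_moment_bound 2.
exists (19 * K) => N N0; rewrite rt4; apply: martingale_fourth_moment => //.
- exact: fmom_innov.
- move=> k _; have Ap := past_A k; have Af := fmom_A k.
  rewrite (_ : (fun w => _) = fun w => e k w * (A k w ^+ 3)).
    by apply: orth1; [past_tac|fmom_tac].
  by apply/funext => w; rewrite mulrC.
Qed.

Lemma psum_Bxi k w : psum Bxi k w = A k w ^+ 2 - k%:R * s2.
Proof.
elim: k => [|k IH]; first by rewrite !psum0 mul0r expr0n subr0.
by rewrite !psumS IH /Bxi -natr1; ring.
Qed.

(** The rate [N] for the square calls for the eighth moment of [A_N]. It comes from the martingale
    [A_k^2 - k s2]: by [O4_A] its increments have fourth moments [O(N^2)], which
    [martingale_fourth_moment] multiplies by [N^2]. *)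
Lemma O4_A2 : O4 P (fun N => N%:R) (fun N w => A N w ^+ 2).
Proof.
have -> : (fun N w => A N w ^+ 2) = fun N w => psum Bxi N w + s2 * N%:R.
  by apply/funext => N; apply/funext => w; rewrite psum_Bxi; ring.
apply: O4D; last first.
  apply: O4Z; split=> [N|]; first exact: fmom_cst.
  by exists 1 => N _; rewrite mean_cst mul1r.
split; first exact: fmom_B.
have [K K0 hK] := Qxi_fourth.
have [C C0 hC] := fmom_moment_bound 2.
have [_ [D hD]] := O4_A.
(* [O4] puts no sign on its constant; the bound at index 1, where [rt 1 = 1], forces it. *)
have D0 : 0 <= D.
  apply: le_trans (_ : E (fun w => A 1 w ^+ 4) <= _).
    by rewrite mean_ge0// => w; rewrite exprn_even_ge0.
  by have := hD 1 isT; rewrite rt4 expr1n mulr1.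
exists (19 * (8 * (16 * D * C + K))) => N N0.
rewrite (_ : _ * N%:R ^+ 4 =
  19 * (8 * (16 * D * C + K) * N%:R ^+ 2) * N%:R ^+ 2); last by ring.
apply: martingale_fourth_moment.
- rewrite mulr_ge0 ?sqr_ge0// mulr_ge0// addr_ge0// ?mulr_ge0//.
- exact: fmom_Bxi.
- move=> k _; have Ap := past_A k; have Af := fmom_A k; have ek := fmom_innov k.
  have Bp := past_B k; have Bf := fmom_B k.
  rewrite (_ : (fun w => _) = fun w => 2 * (e k w * (A k w * psum Bxi k w ^+ 3))
     + (e k w ^+ 2 * (psum Bxi k w ^+ 3) - s2 * psum Bxi k w ^+ 3)); last first.
    by apply/funext => w; rewrite /Bxi; ring.
  rewrite meanD ?meanB ?meanZ ?orth1 ?orth2 ?subrr ?mulr0 ?addr0//;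
    by [past_tac|fmom_tac].
- move=> k kN; have Ap := past_A k; have Af := fmom_A k; have ek := fmom_innov k.
  have Qf := fmom_Qxi k.
  apply: (@le_trans _ _ (E (fun w => 8 * (16 * (e k w ^+ 4 * A k w ^+ 4) + Qxi k w ^+ 4)))).
    apply: le_mean => [||w]; [by have := fmom_Bxi k => ?; fmom_tac|by fmom_tac|].
    have := exprD4_le (2 * (A k w * e k w)) (Qxi k w).
    by rewrite (_ : (2 * (A k w * e k w)) ^+ 4 = 16 * (e k w ^+ 4 * A k w ^+ 4)); last by ring.
  rewrite meanZ ?meanD ?meanZ; try by fmom_tac.
  rewrite (AR1m_indep hx); [|by past_tac|by fmom_tac].
  rewrite -mulrA ler_wpM2l// [X in _ <= X]mulrDl; apply: lerD; last first.
    by rewrite (le_trans (hK k))// ler_peMr// exprn_ege1// ler1n.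
  rewrite -!mulrA ler_wpM2l// [D * _]mulrCA ler_pM//.
  + by rewrite mean_ge0// => w; rewrite exprn_even_ge0.
  + by rewrite mean_ge0// => w; rewrite exprn_even_ge0.
  (* The bound on [A k] holds at positive indices; the empty sum is treated apart. *)
  case: k kN {Ap Af ek Qf} => [_|k kN].
    rewrite (_ : (fun w => _) = fun=> 0); last first.
      by apply/funext => w; rewrite psum0 expr0n.
    by rewrite mean_cst mulr_ge0// sqr_ge0.
  apply: (le_trans (hD k.+1 isT)); rewrite rt4 ler_wpM2l//.
  by rewrite lerXn2r ?nnegrE// ler_nat ltnW.
Qed.

Lemma mean_M k : E (M k) = 0.
Proof.
elim: k => [|k IH].
  by rewrite (_ : M 0 = fun=> 0) ?mean_cst//; apply/funext => w; rewrite psum0.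
rewrite (_ : M k.+1 = fun w => M k w + Mxi k w); last first.
  by apply/funext => w; rewrite psumS.
have xp := @past_x k k (leqnn k); have xf := fmom_x k.
rewrite meanD ?IH ?add0r; [|exact: fmom_M|exact: fmom_Mxi].
exact: orth1.
Qed.

(** The increments are orthogonal, and each contributes [E e^2 E x^2] by independence. *)
Lemma mean_M2 k : E (fun w => M k w ^+ 2) = k%:R * (s2 * ar_var).
Proof.
elim: k => [|k IH].
  rewrite mul0r (_ : (fun w => _) = fun=> 0) ?mean_cst//.
  by apply/funext => w; rewrite psum0 expr0n.
have xp := @past_x k k (leqnn k); have xf := fmom_x k.
have Mp := past_M k; have Mf := fmom_M k; have ek := fmom_innov k.
rewrite (_ : (fun w => _) = fun w => M k w ^+ 2 + 2 * (e k w * (M k w * x k w))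
   + e k w ^+ 2 * x k w ^+ 2); last first.
  by apply/funext => w; rewrite psumS /Mxi; ring.
rewrite !meanD ?meanZ ?IH ?orth1 ?orth2 ?mean_x2; try by [past_tac|fmom_tac].
by rewrite -natr1; ring.
Qed.

(* The third moment of the noise cancels because it comes multiplied by [E x = 0]. *)
Lemma mean_MQ k : E (fun w => M k w * Q k w) = 0.
Proof.
elim: k => [|k IH].
  rewrite (_ : (fun w => _) = fun=> 0) ?mean_cst//.
  by apply/funext => w; rewrite psum0 mul0r.
have xp := @past_x k k (leqnn k); have xf := fmom_x k.
have Mp := past_M k; have Mf := fmom_M k; have ek := fmom_innov k.
have Qp := past_Q k; have Qf := fmom_Q k.
rewrite (_ : (fun w => _) = fun w => M k w * Q k w + (e k w ^+ 2 * M k w - s2 * M k w)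
   + (e k w * (x k w * Q k w) + (e k w ^+ 3 * x k w - s2 * (e k w * x k w)))); last first.
  by apply/funext => w; rewrite !psumS /Mxi /Qxi; ring.
rewrite !(meanB, meanD) ?meanZ; try by fmom_tac.
rewrite IH ?orth1 ?orth2 ?(AR1m_indep hx); try by [past_tac|fmom_tac].
by rewrite mean_M mean_x; ring.
Qed.

Lemma mean_A2 k : E (fun w => A k w ^+ 2) = k%:R * s2.
Proof.
elim: k => [|k IH].
  rewrite mul0r (_ : (fun w => _) = fun=> 0) ?mean_cst//.
  by apply/funext => w; rewrite psum0 expr0n.
have Ap := past_A k; have Af := fmom_A k; have ek := fmom_innov k.
rewrite (_ : (fun w => _) = fun w => A k w ^+ 2 + 2 * (e k w * A k w) + e k w ^+ 2); last first.
  by apply/funext => w; rewrite psumS; ring.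
rewrite !meanD ?meanZ ?IH ?(AR1m_var hx) ?orth1; try by [past_tac|fmom_tac].
by rewrite -natr1; ring.
Qed.

End AR1_moment_bounds.
Arguments rt {R} N.

(** * Expansion of a perturbed Burg quotient *)

Section ratio_expansion.
Context d (T : measurableType d) (R : realType) (P : probability T R).

Lemma norm_mul_sqr_le (a b : R) : `|a| * b ^+ 2 <= 1 + a ^+ 4 + b ^+ 4.
Proof.
rewrite -[a ^+ 4]/(a ^+ (2 * 2)) -[b ^+ 4]/(b ^+ (2 * 2)) !exprM.
rewrite -(real_normK (num_real a)); move: `|a| (b ^+ 2) => u v.
have := sqr_ge0 (u - v); have := sqr_ge0 (u ^+ 2 - 1).
by have := sqr_ge0 (u ^+ 2); have := sqr_ge0 v; lra.
Qed.

(** Third-order counterpart of [O4_mean_prod], for the terms [|U| G^2] and [|G|^3] of the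
    remainder. *)
Lemma O4_mean_cube (r : nat -> R) (Y Z : nat -> T -> R) :
  (forall N, (0 < N)%N -> 0 < r N) -> O4 P r Y -> O4 P r Z ->
  exists C, forall N, (0 < N)%N ->
    mean P (fun w => `|Y N w| * Z N w ^+ 2) <= C * r N ^+ 3.
Proof.
move=> r0 [Yf [C hC]] [Zf [D hD]]; exists (1 + C + D) => N N0.
have YN := Yf N; have ZN := Zf N; have {}r0 := r0 _ N0.
pose u : R := (r N)^-1.
have u0 : 0 < u by rewrite invr_gt0.
rewrite mulrC -ler_pdivrMl ?exprn_gt0// -exprVn -/u -meanZ; last by fmom_tac.
apply: (@le_trans _ _ (mean P (fun w => 1 + u ^+ 4 * Y N w ^+ 4 + u ^+ 4 * Z N w ^+ 4))).
  apply: le_mean => [||w]; [by fmom_tac|by fmom_tac|].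
  rewrite -!exprMn; apply: le_trans (norm_mul_sqr_le _ _).
  by rewrite normrM gtr0_norm// le_eqVlt; apply/orP; left; apply/eqP; ring.
rewrite !meanD ?meanZ ?mean_cst; try by fmom_tac.
apply: lerD; first apply: lerD => //.
  by rewrite /u exprVn ler_pdivrMl ?exprn_gt0// mulrC hC.
by rewrite /u exprVn ler_pdivrMl ?exprn_gt0// mulrC hD.
Qed.

(** The relation [r (m + G) = U] is solved for [r] by dividing by [m] alone, since [m + G] may
    vanish. The crude bound on [r] enters through [r = (U - r G) / m], which gains the third power
    of [m]. *)
Lemma ratio_expansion (m U G r : R) : 0 < m -> r * (m + G) = U -> `|r| <= 2 ->
  `|r - (U / m - U * G / m ^+ 2)| <= (`|U| * G ^+ 2 + 2 * (`|G| * G ^+ 2)) / m ^+ 3.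
Proof.
move=> m0 rU r2; have mn0 : m != 0 by rewrite gt_eqF.
have rE : r = (U - r * G) / m by rewrite -rU; field.
have -> : r - (U / m - U * G / m ^+ 2) = r * (G ^+ 2 / m ^+ 2).
  by rewrite -rU; field.
have hr : `|r| <= (`|U| + 2 * `|G|) / m.
  rewrite {1}rE normrM normfV (gtr0_norm m0) ler_pM2r ?invr_gt0//.
  rewrite (le_trans (ler_normB _ _))// lerD2l normrM.
  by rewrite ler_wpM2r.
rewrite normrM [X in _ * X]ger0_norm ?divr_ge0 ?sqr_ge0//.
have -> : (`|U| * G ^+ 2 + 2 * (`|G| * G ^+ 2)) / m ^+ 3 =
  (`|U| + 2 * `|G|) / m * (G ^+ 2 / m ^+ 2) by field.
by rewrite ler_wpM2r// divr_ge0 ?sqr_ge0.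
Qed.

Context (rho s2 : R) (x : nat -> T -> R).
Context (hrho : `|rho| < 1) (s2_gt0 : 0 < s2) (hx : AR1_moments P rho s2 x).

Local Notation E := (mean P).
Local Notation M := (psum (Mxi rho x)).
Local Notation Q := (psum (Qxi rho s2 x)).
Local Notation A := (psum (innov rho x)).
Local Notation v := (ar_var rho s2).
Local Notation one := (fun _ : nat => 1 : R).

(** Denominator and numerator of the quotient for the [N + 1] centered observations
    [x 0, ..., x N]. *)
Definition sum_sqr N : T -> R :=
  fun w => \sum_(i < N) (x i.+1 w ^+ 2 + x i w ^+ 2).
Definition sum_prod N : T -> R :=
  fun w => 2 * \sum_(i < N) x i.+1 w * x i w.
Definition boundary N : T -> R := fun w => x 0 w ^+ 2 - x N w ^+ 2.

(** Substituting [x_(i+1) = rho x_i + e_i] in the product turns each summand into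
    [2 e_i x_i + rho (x_i^2 - x_(i+1)^2)], whose last part telescopes. *)
Lemma score_eq N w :
  sum_prod N w - rho * sum_sqr N w = 2 * M N w + rho * boundary N w.
Proof.
rewrite /sum_prod /sum_sqr /boundary; elim: N => [|N IH].
  by rewrite !big_ord0 psum0; ring.
rewrite !big_ord_recr /= psumS /Mxi /innov.
by move: IH; set a := \sum_(i < N) _; set b := \sum_(i < N) _; lra.
Qed.

Lemma ar_var_gt0 : 0 < v.
Proof. by rewrite divr_gt0 ?subr_rho2_gt0. Qed.

(** Summand by summand, the products [x_(i+1) x_i] cancel between [4 rho e_i x_i] and [2 e_i^2]; the
    squares that remain give the left side and a telescoping part. *)
Lemma sum_sqr_eq N w : (1 - rho ^+ 2) * (sum_sqr N w - N%:R * (2 * v)) =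
  (1 + rho ^+ 2) * boundary N w + 4 * rho * M N w + 2 * Q N w.
Proof.
have vE : (1 - rho ^+ 2) * v = s2.
  by rewrite mulrC divfK// gt_eqF// subr_rho2_gt0.
rewrite mulrBr [_ * (N%:R * _)](_ : _ = N%:R * (2 * ((1 - rho ^+ 2) * v))); last by ring.
rewrite vE.
rewrite /sum_sqr /boundary; elim: N => [|N IH].
  by rewrite !big_ord0 !psum0; ring.
rewrite !big_ord_recr /= !psumS /Mxi /Qxi /innov -natr1.
by move: IH; set a := \sum_(i < N) _; lra.
Qed.

Lemma fmom_boundary N : fmom P (boundary N).
Proof.
have x0 := fmom_x hx 0; have xN := fmom_x hx N.
by rewrite /boundary; fmom_tac.
Qed.

Lemma mean_boundary N : E (boundary N) = 0.
Proof.
have x0 := fmom_x hx 0; have xN := fmom_x hx N.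
by rewrite /boundary meanB ?(AR1m_stat hx N) ?subrr//; fmom_tac.
Qed.

Lemma O4_x : O4 P one x.
Proof.
split; first exact: fmom_x hx.
by exists (E (fun w => x 0 w ^+ 4)) => N _; rewrite (AR1m_stat hx) expr1n mulr1.
Qed.

Lemma O4_x2 : O4 P one (fun N w => x N w ^+ 2).
Proof.
split=> [N|]; first by have := fmom_x hx N => ?; fmom_tac.
exists (E (fun w => x 0 w ^+ 8)) => N _; rewrite expr1n mulr1 -(AR1m_stat hx N 8).
by under eq_fun do rewrite -exprM.
Qed.

Lemma O4_stat f : fmom P f -> O4 P one (fun=> f).
Proof.
move=> ff; split=> //; exists (E (fun w => f w ^+ 4)) => N _.
by rewrite expr1n mulr1.
Qed.

Lemma O4N r Y : O4 P r Y -> O4 P r (fun N w => - Y N w).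
Proof.
move=> /(O4Z (-1)); congr O4; apply/funext => N; apply/funext => w.
by rewrite mulN1r.
Qed.

Lemma O4_boundary : O4 P one boundary.
Proof.
apply: O4D; last exact: O4N O4_x2.
by apply: O4_stat; have := fmom_x hx 0 => ?; fmom_tac.
Qed.

Lemma O4_one_rt Y : O4 P one Y -> O4 P rt Y.
Proof. by apply: O4_mono => N N0; rewrite ler01 rt_ge1. Qed.

(** Common to both estimators: [kappa] is what centering adds to numerator and denominator, [k0] the
    limit of its mean, [r] the estimation error. The constant [-2 rho] is [N] times
    [- 8 rho v^2 N / (2 v N)^2], and [k0] enters through [E U = (1 - rho) E kappa]. *)
Theorem bias_rate (kappa r : nat -> T -> R) (k0 : R) :
  O4 P one kappa ->
  (exists C, forall N, (0 < N)%N -> `|E (kappa N) - k0| <= C / rt N) ->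
  (forall N, measurable_fun setT (r N)) ->
  (forall N w, (0 < N)%N -> `|r N w| <= 2) ->
  (forall N w, (0 < N)%N -> r N w * (sum_sqr N w + kappa N w) =
     sum_prod N w - rho * sum_sqr N w + (1 - rho) * kappa N w) ->
  exists C, forall N, (0 < N)%N ->
    `|E (r N) - ((1 - rho) * k0 / (2 * v) - 2 * rho) / N%:R| <= C / (N%:R * rt N).
Proof.
move=> ko [C0 hC0] rm r2 rD.
pose w0 := 1 - rho ^+ 2.
have w0_gt0 : 0 < w0 by exact: subr_rho2_gt0.
have v0 := ar_var_gt0.
(* [g1] and [u1] collect the [O(1)] parts of the centered denominator [G] and of the score [U]; the
   martingale parts are of order [rt N]. *)
pose g1 N w := (1 + rho ^+ 2) / w0 * boundary N w + kappa N w.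
pose u1 N w := rho * boundary N w + (1 - rho) * kappa N w.
pose G N w := (4 * rho / w0 * M N w + 2 / w0 * Q N w) + g1 N w.
pose U N w := 2 * M N w + u1 N w.
have oM := O4_M hx; have oQ := O4_Q hx.
have oB := O4_boundary.
have og1 : O4 P one g1 by apply: O4D => //; exact: O4Z.
have ou1 : O4 P one u1 by apply: O4D; exact: O4Z.
have oG : O4 P rt G.
  by apply: O4D; [apply: O4D; exact: O4Z|exact: O4_one_rt].
have oU : O4 P rt U by apply: O4D; [exact: O4Z|exact: O4_one_rt].
have one0 N : (0 < N)%N -> 0 < one N by [].
have rt0 N : (0 < N)%N -> 0 < rt N :> R by exact: rt_gt0.
have [C1 hC1] := O4_mean_prod rt0 one0 oM og1.
have [C2 hC2] := O4_mean_prod one0 rt0 ou1 oG.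
have [C3 hC3] := O4_mean_cube rt0 oU oG.
have [C4 hC4] := O4_mean_cube rt0 oG oG.
(* In order: the deviation of [E kappa] from [k0], the terms of [E (U G)] with an [O(1)] factor, and
   the cubic remainder. *)
exists ((1 - rho) * C0 / (2 * v) + (2 * C1 + C2) / (4 * v ^+ 2)
  + (C3 + 2 * C4) / (8 * v ^+ 3)) => N N0.
have Mf := fmom_M hx N; have Qf := fmom_Q hx N.
have kf : fmom P (kappa N) by case: ko.
have Bf := fmom_boundary N.
have gf : fmom P (g1 N) by case: og1.
have uf : fmom P (u1 N) by case: ou1.
have Gf : fmom P (G N) by case: oG.
have Uf : fmom P (U N) by case: oU.
have rf : fmom P (r N).
  by apply: (fmom_dominated (rm N) (fmom_cst P 2)) => w; exact: r2.
pose n : R := N%:R.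
have n0 : 0 < n by rewrite ltr0n.
pose m := n * (2 * v).
have m0 : 0 < m by rewrite mulr_gt0// mulr_gt0.
have GE w : sum_sqr N w + kappa N w = m + G N w.
  have := sum_sqr_eq N w; rewrite -/w0 -/n -/m => h.
  rewrite /G /g1 -[LHS](subrKC m) (_ : _ - m = kappa N w + (sum_sqr N w - m)); last by ring.
  by rewrite -[sum_sqr N w - m](mulKf (lt0r_neq0 w0_gt0)) h; field; rewrite gt_eqF.
have rmG w : r N w * (m + G N w) = U N w.
  by rewrite -GE rD// score_eq /U /u1; ring.
have EU : E (U N) = (1 - rho) * E (kappa N).
  rewrite /U /u1 !meanD ?meanZ; try by fmom_tac.
  by rewrite (mean_M hx) mean_boundary; ring.
(* Only the term in [M^2] has order [n]: the term in [M Q] has mean zero, and the others pair [g1]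
   with [M] or [u1] with [G]. *)
have EUG : E (fun w => U N w * G N w) = 8 * rho * v ^+ 2 * n +
   (2 * E (fun w => M N w * g1 N w) + E (fun w => u1 N w * G N w)).
  rewrite (_ : (fun w => U N w * G N w) = fun w => (8 * rho / w0 * M N w ^+ 2
     + 4 / w0 * (M N w * Q N w)) + (2 * (M N w * g1 N w) + u1 N w * G N w)); last first.
    apply/funext => w; rewrite /U mulrDl addrA; congr (_ + _).
    by rewrite /G; ring.
  rewrite !meanD ?meanZ; try by fmom_tac.
  rewrite (mean_M2 hrho hx) (mean_MQ hrho hx) -/n mulr0 addr0; congr (_ + _).
  by rewrite /ar_var -/w0; field; rewrite gt_eqF.
pose rem := E (fun w => r N w - (U N w / m - U N w * G N w / m ^+ 2)).
have rem_le : `|rem| <= (C3 + 2 * C4) * rt N ^+ 3 / m ^+ 3.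
  apply: (@le_trans _ _ (E (fun w => (m ^+ 3)^-1 * (`|U N w| * G N w ^+ 2
     + 2 * (`|G N w| * G N w ^+ 2))))).
    apply: norm_mean_le => [||w]; [by fmom_tac|by fmom_tac|].
    by rewrite [X in _ <= X]mulrC; apply: ratio_expansion; rewrite ?r2.
  rewrite meanZ ?meanD ?meanZ; try by fmom_tac.
  rewrite mulrC ler_pM2r ?invr_gt0 ?exprn_gt0// [X in _ <= X]mulrDl.
  apply: lerD; first exact: hC3.
  by rewrite -mulrA ler_wpM2l// hC4.
have remE : rem = E (r N) - ((1 - rho) * E (kappa N) / m -
    E (fun w => U N w * G N w) / m ^+ 2).
  rewrite /rem meanB ?meanB; try by fmom_tac.
  congr (_ - (_ - _)).
    by under eq_fun do rewrite mulrC; rewrite meanZ// EU mulrC.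
  by under eq_fun do rewrite mulrC; rewrite meanZ; [rewrite mulrC|fmom_tac].
(* With [n = s^2] all rates become rational in [s], so [field] can check the final split into three
   errors. *)
pose s : R := rt N.
have s0 : 0 < s by exact: rt0.
have ns : n = s ^+ 2 by rewrite rt2.
have := hC0 _ N0; have := hC1 _ N0; have := hC2 _ N0; move: rem_le remE.
rewrite EUG mulr1 mul1r -/s -/n /m.
move: (E (kappa N)) (E (r N)) (E (fun w => M N w * g1 N w))
  (E (fun w => u1 N w * G N w)) rem => a e b c q.
move=> hq qE hc hb ha.
have vn : v != 0 by rewrite gt_eqF.
have sn : s != 0 by rewrite gt_eqF.
rewrite (_ : e - _ = (1 - rho) / (2 * v * n) * (a - k0) -
   (2 * b + c) / (4 * v ^+ 2 * n ^+ 2) + q); last first.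
  by rewrite qE ns; field; rewrite sn vn.
rewrite (_ : _ / (n * s) = (1 - rho) / (2 * v * n) * (C0 / s) +
   (2 * C1 + C2) * s / (4 * v ^+ 2 * n ^+ 2) +
   (C3 + 2 * C4) * s ^+ 3 / (n * (2 * v)) ^+ 3); last first.
  by rewrite ns; field; rewrite sn vn.
apply: (le_trans (ler_normD _ _)); apply: lerD => //.
apply: (le_trans (ler_normB _ _)); apply: lerD.
  have c0 : 0 <= (1 - rho) / (2 * v * n).
    apply: divr_ge0; first exact: ltW (subr_rho_gt0 hrho).
    by apply: ltW; rewrite mulr_gt0// mulr_gt0.
  by rewrite normrM ger0_norm// ler_wpM2l.
have d0 : 0 < 4 * v ^+ 2 * n ^+ 2 by apply: mulr_gt0; [apply: mulr_gt0 => //|]; exact: exprn_gt0.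
rewrite normrM normfV (gtr0_norm d0) ler_pM2r ?invr_gt0//.
apply: (le_trans (ler_normD _ _)); rewrite [X in _ <= X]mulrDl.
apply: lerD => //; rewrite normrM ger0_norm// -mulrA.
by rewrite ler_wpM2l.
Qed.

End ratio_expansion.

(** * Independence and the normal law *)

Section independence.
Context d (T : measurableType d) (R : realType) (P : probability T R).

(** The hypothesis on rectangles identifies the joint law with the product of the marginals, and
    Fubini applies; integrability for the product law is carried over from the joint law. *)
Lemma independent_meanM (X Y : {RV P >-> R}) :
  (forall A B : set R, measurable A -> measurable B ->
    P (X @^-1` A `&` Y @^-1` B) = (P (X @^-1` A) * P (Y @^-1` B))%E) ->
  P.-integrable setT (EFin \o X) -> P.-integrable setT (EFin \o Y) ->
  P.-integrable setT (EFin \o (fun w => X w * Y w)) ->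
  mean P (fun w => X w * Y w) = mean P X * mean P Y.
Proof.
move=> XY iX iY iXY.
have mpair : measurable_fun setT (fun w => (X w, Y w)).
  by apply: measurable_fun_pair.
pose Z : {RV P >-> (R * R)%type} :=
  HB.pack (fun w => (X w, Y w)) (@isMeasurableFun.Build _ _ _ _ (fun w => (X w, Y w)) mpair).
pose f (p : R * R) : \bar R := (p.1 * p.2)%:E.
have mf : measurable_fun setT f.
  by apply/measurable_EFinP; apply: measurable_funM.
have prodE (B : set (R * R)) : measurable B ->
    (distribution P X \x distribution P Y)%E B = distribution P Z B.
  by apply: product_measure_unique => A B' mA mB'; rewrite /distribution /pushforward /= -XY.
have intm' : (distribution P Z).-integrable setT f.
  by apply: integrable_pushforward.
have absE : (\int[distribution P X \x distribution P Y]_p `|f p| =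
    \int[distribution P Z]_p `|f p|)%E.
  by apply: eq_measure_integral => B mB _; exact: prodE.
have intp : (distribution P X \x distribution P Y)%E.-integrable setT f.
  by apply/integrableP; split => //; rewrite absE; case/integrableP: intm'.
have EXY : (\int[P]_w (X w * Y w)%:E =
    \int[distribution P X]_a \int[distribution P Y]_b (a * b)%:E)%E.
  rewrite -[LHS](integral_distribution (X := Z) mf iXY).
  rewrite (integral12_prod_meas1 intp).
  by apply: eq_measure_integral => B mB _; exact: esym (prodE B mB).
have mid : measurable_fun setT (fun b : R => b%:E) by exact/measurable_EFinP.
have EY : (\int[distribution P Y]_b b%:E = (mean P Y)%:E)%E.
  rewrite (integral_distribution (X := Y) mid iY) /mean /Rintegral fineK//.
  exact: integrable_fin_num.
have EX : (\int[distribution P X]_b b%:E = (mean P X)%:E)%E.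
  rewrite (integral_distribution (X := X) mid iX) /mean /Rintegral fineK//.
  exact: integrable_fin_num.
have iYd : (distribution P Y).-integrable setT (fun b : R => b%:E).
  by apply: integrable_pushforward.
have iXd : (distribution P X).-integrable setT (fun b : R => b%:E).
  by apply: integrable_pushforward.
rewrite {1}/mean /Rintegral EXY.
under eq_integral.
  move=> a _; under eq_integral do rewrite EFinM.
  rewrite integralZl// EY; over.
by rewrite integralZr// EX.
Qed.

End independence.

(** * Moments of the centered normal law *)

Section normal_moments.
Context (R : realType).
Local Notation mu := (@lebesgue_measure R).
Implicit Types (sigma : R).

(** The Radon-Nikodym derivative and the explicit density have equal integrals over every measurable
    set, hence agree almost everywhere. *)
Lemma ge0_integral_normal_prob sigma (f : R -> \bar R) :
  measurable_fun setT f -> (forall y, 0 <= f y)%E ->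
  (\int[normal_prob 0 sigma]_y f y =
   \int[mu]_y (f y * (normal_pdf 0 sigma y)%:E))%E.
Proof.
move=> mf f0; have dom := @normal_prob_dominates R 0 sigma.
have mpdf : measurable_fun setT (fun y => (normal_pdf 0 sigma y)%:E).
  by apply/measurable_EFinP; exact: measurable_normal_pdf.
have iRN := Radon_Nikodym_SigmaFinite.f_integrable dom.
rewrite -(Radon_Nikodym_SigmaFinite.change_of_variables dom)//.
apply: ae_eq_integral => //.
- by apply: emeasurable_funM => //; exact: measurable_int iRN.
- exact: emeasurable_funM.
- apply: ae_eqe_mul2l; apply: integral_ae_eq => //.
  by move=> A _ mA; rewrite -Radon_Nikodym_SigmaFinite.f_integral.
Qed.

(** With [u = t / (p + 1)], [u <= expR u] gives [u^p <= expR (p u) <= expR t]. Dividing by [p + 1]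
    rather than [p] covers [p = 0]. *)
Lemma exprn_le_expR (t : R) p : 0 <= t -> t ^+ p <= p.+1%:R ^+ p * expR t.
Proof.
move=> t0; pose u := t / p.+1%:R.
have u0 : 0 <= u by rewrite divr_ge0.
have -> : t ^+ p = p.+1%:R ^+ p * u ^+ p.
  by rewrite -exprMn mulrC divfK// pnatr_eq0.
rewrite ler_wpM2l ?exprn_ge0//; apply: (@le_trans _ _ (expR u ^+ p)).
  rewrite lerXn2r ?nnegrE ?expR_ge0//.
  by apply: le_trans (expR_ge1Dx u); rewrite lerDr.
rewrite -expRM_natl ler_expR /u mulrCA ler_piMr// ler_pdivrMr ?mul1r//.
by rewrite ler_nat.
Qed.

Lemma normal_pdf_moment_le sigma p : sigma != 0 -> exists2 C, 0 <= C &
  forall y, y ^+ (2 * p) * normal_pdf 0 sigma y <= C * normal_pdf 0 (2 * sigma) y.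
Proof.
move=> s0; have s20 : 2 * sigma != 0 by rewrite mulf_neq0// pnatr_eq0.
(* [1 / (2 sigma^2) - 1 / (8 sigma^2)], the gap between the two Gaussian exponents, which absorbs
   the power of [y]. *)
pose c := 3 / (8 * sigma ^+ 2).
have sq0 : 0 < sigma ^+ 2 by rewrite exprn_even_gt0.
have c0 : 0 < c by rewrite divr_gt0// mulr_gt0.
pose K := normal_peak sigma / normal_peak (2 * sigma).
have K0 : 0 <= K by rewrite divr_ge0// normal_peak_ge0.
exists (c^-1 ^+ p * p.+1%:R ^+ p * K).
  apply: mulr_ge0 => //; apply: mulr_ge0; apply: exprn_ge0 => //.
  by rewrite invr_ge0 ltW.
move=> y; rewrite !normal_pdfE// /normal_fun !subr0.
have t0 : 0 <= c * y ^+ 2 by rewrite mulr_ge0 ?sqr_ge0// ltW.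
have yp : y ^+ (2 * p) = c^-1 ^+ p * (c * y ^+ 2) ^+ p.
  by rewrite -exprMn mulKf ?gt_eqF// exprM.
have -> : - y ^+ 2 / (sigma ^+ 2 *+ 2) =
    - (c * y ^+ 2) + - y ^+ 2 / ((2 * sigma) ^+ 2 *+ 2).
  by rewrite /c; field.
rewrite expRD; set g := expR (_ / _).
have g0 : 0 < g by exact: expR_gt0.
rewrite yp (_ : _ * K * _ = c^-1 ^+ p * (p.+1%:R ^+ p *
   (normal_peak sigma * g))); last first.
  by rewrite /K; field; rewrite gt_eqF// normal_peak_gt0.
rewrite (_ : _ * _ * (_ * (_ * g)) = c^-1 ^+ p * ((c * y ^+ 2) ^+ p * expR (- (c * y ^+ 2))
   * (normal_peak sigma * g))); last by ring.
apply: ler_wpM2l; first by rewrite exprn_ge0// invr_ge0 ltW.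
apply: ler_wpM2r; first by rewrite mulr_ge0 ?normal_peak_ge0 ?expR_ge0.
by rewrite expRN ler_pdivrMr ?expR_gt0// exprn_le_expR.
Qed.

Lemma normal_prob_moment_lty sigma p : sigma != 0 ->
  (\int[normal_prob 0 sigma]_y (y ^+ (2 * p))%:E < +oo)%E.
Proof.
move=> s0; have [C C0 hC] := normal_pdf_moment_le p s0.
have mX : measurable_fun setT (fun y : R => (y ^+ (2 * p))%:E).
  by apply/measurable_EFinP; exact: measurable_funX.
have X0 (y : R) : 0 <= y ^+ (2 * p) by rewrite exprM exprn_ge0 ?sqr_ge0.
rewrite ge0_integral_normal_prob//.
apply: (@le_lt_trans _ _ (\int[mu]_y (C%:E * (normal_pdf 0 (2 * sigma) y)%:E))%E).
  apply: ge0_le_integral => //.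
  - by move=> y _; rewrite mule_ge0// lee_fin// normal_pdf_ge0.
  - apply: emeasurable_funM => //.
    by apply/measurable_EFinP; exact: measurable_normal_pdf.
  - apply: emeasurable_funM => //.
    by apply/measurable_EFinP; exact: measurable_normal_pdf.
  - by move=> y _; rewrite -!EFinM lee_fin hC.
rewrite integralZl//; last exact: integrable_normal_pdf.
by rewrite integral_normal_pdf mule1 ltry.
Qed.

(* Symmetry of the law, in the form used for the mean: [y = 2 max(y, 0) - |y|]. *)
Lemma normal_prob_abs_half sigma : sigma != 0 ->
  (\int[normal_prob 0 sigma]_y (`|y|)%:E =
   2%:E * \int[normal_prob 0 sigma]_y (Num.max y 0)%:E)%E.
Proof.
move=> s0.
have cpdf := @continuous_normal_pdf R 0 sigma s0.
have mmax : measurable_fun setT (fun y : R => (Num.max y 0)%:E).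
  by apply/measurable_EFinP; exact: measurable_maxr.
have mabs : measurable_fun setT (fun y : R => (`|y|)%:E).
  by apply/measurable_EFinP; exact: normr_measurable.
have max0 (y : R) : (0 <= (Num.max y 0)%:E)%E by rewrite lee_fin le_max lexx orbT.
rewrite !ge0_integral_normal_prob//.
under eq_integral do rewrite -EFinM.
rewrite (@ge0_symfun_integralT _ (fun y => `|y| * normal_pdf 0 sigma y)); last 3 first.
- by move=> y; rewrite mulr_ge0// normal_pdf_ge0.
- by move=> y; apply: cvgM; [exact: norm_continuous|exact: cpdf].
- by move=> y /=; rewrite normrN !normal_pdfE// /normal_fun !subr0 sqrrN.
congr (_ * _)%E; rewrite integral_mkcond; apply: eq_integral => y _.
rewrite patchE; case: ifPn => [|/negP]; rewrite inE/= => y0.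
  by rewrite ger0_norm// max_l.
by rewrite max_r ?mul0e// ltW// ltNge; exact/negP.
Qed.

End normal_moments.

(** * From the normal law to the noise variables *)

Section noise.
Context d (T : measurableType d) (R : realType) (P : probability T R).

(** Even powers are non-negative, so a finite integral is enough for them; all powers follow from
    [|f^p| <= 1 + f^(2 p)]. *)
Lemma fmom_even (f : T -> R) : measurable_fun setT f ->
  (forall p, (\int[P]_w (f w ^+ (2 * p))%:E < +oo)%E) -> fmom P f.
Proof.
move=> mf h p.
have ev w q : 0 <= f w ^+ (2 * q) by rewrite exprM exprn_ge0 ?sqr_ge0.
have i2 : P.-integrable setT (EFin \o (fun w => f w ^+ (2 * p))).
  apply/integrableP; split; first by apply/measurable_EFinP; exact: measurable_funX.
  by under eq_integral do rewrite /= ger0_norm//; exact: h.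
apply: (@integrable_dominated _ _ _ _ _ (fun w => 1 + f w ^+ (2 * p))).
- exact: measurable_funX.
- have := integrableD measurableT (fmom_integrable (fmom_cst P 1)) i2.
  by apply: eq_integrable.
- move=> w; rewrite mulnC exprM -(real_normK (num_real (f w ^+ p))).
  by move: `|_| => u; have := sqr_ge0 (u - 1); have := sqr_ge0 u; lra.
Qed.

Context (sigma : R) (a : {RV P >-> R}) (s0 : sigma != 0).
Context (ha : forall A : set R, measurable A -> distribution P a A = normal_prob 0 sigma A).

Lemma ge0_integral_normal_RV (f : R -> \bar R) :
  measurable_fun setT f -> (forall y, 0 <= f y)%E ->
  (\int[P]_w f (a w) = \int[normal_prob 0 sigma]_y f y)%E.
Proof.
move=> mf f0.
(* [normal_prob] is a measure on [measurableTypeR R], whose display is not that of [R]. *)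
have ma : measurable_fun setT (a : T -> measurableTypeR R) := measurable_funP a.
pose a' : {RV P >-> measurableTypeR R} :=
  HB.pack (a : T -> measurableTypeR R) (isMeasurableFun.Build _ _ _ _ _ ma).
transitivity (\int[distribution P a']_y f y)%E.
  by rewrite (ge0_integral_distribution a').
by apply: eq_measure_integral => A mA _; exact: (ha mA).
Qed.

Lemma fmom_normal : fmom P a.
Proof.
apply: fmom_even => // p.
rewrite (ge0_integral_normal_RV (f := fun y => (y ^+ (2 * p))%:E)).
- exact: normal_prob_moment_lty.
- by apply/measurable_EFinP; exact: measurable_funX.
- by move=> y; rewrite lee_fin exprM exprn_ge0 ?sqr_ge0.
Qed.

Lemma mean_normal : mean P a = 0.
Proof.
have af := fmom_normal.
have afm : fmom P (fun w => Num.max (a w) 0).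
  apply: (fmom_dominated _ (fmom_norm af)); first exact: measurable_maxr.
  by move=> w; rewrite /Num.max; case: ifP => // _; rewrite normr0.
have half : mean P (fun w => `|a w|) = 2 * mean P (fun w => Num.max (a w) 0).
  rewrite /mean /Rintegral.
  rewrite (ge0_integral_normal_RV (f := fun y => (`|y|)%:E)); last 2 first.
  - by apply/measurable_EFinP; exact: normr_measurable.
  - by move=> y; rewrite lee_fin.
  rewrite normal_prob_abs_half//.
  rewrite -(ge0_integral_normal_RV (f := fun y => (Num.max y 0)%:E)); last 2 first.
  - by apply/measurable_EFinP; exact: measurable_maxr.
  - by move=> y; rewrite lee_fin le_max lexx orbT.
  by rewrite fineM//; apply: integrable_fin_num => //; exact: fmom_integrable afm.
rewrite (_ : (a : T -> R) = fun w => 2 * Num.max (a w) 0 - `|a w|); last first.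
  apply/funext => w; rewrite /Num.max; case: ltP => [a0|a0].
    by rewrite ltr0_norm//; lra.
  by rewrite ger0_norm//; lra.
rewrite meanB ?meanZ// ?half ?subrr//; first exact: fmomZ.
exact: fmom_norm.
Qed.

(** A vanishing second moment would make [a] null almost surely, whereas the normal law, dominated
    by Lebesgue measure, gives no mass to 0. *)
Lemma mean_normal2_gt0 : 0 < mean P (fun w => a w ^+ 2).
Proof.
have af := fmom_normal.
rewrite lt_neqAle mean_ge0 ?andbT; last by move=> w; exact: sqr_ge0.
apply/negP => /eqP E0.
have : (\int[P]_w `|(a w ^+ 2)%:E| = 0)%E.
  under eq_integral do rewrite gee0_abs ?lee_fin ?sqr_ge0//.
  rewrite -[LHS]fineK; last by apply: integrable_fin_num => //; exact: (af 2).
  by rewrite -/(Rintegral _ _ _) -/(mean _ _) -E0.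
have m2 : measurable_fun setT (fun w => (a w ^+ 2)%:E).
  by apply/measurable_EFinP; exact: measurable_funX.
move/(ae_eq_integral_abs P measurableT m2) => a0.
have mz : measurable (a @^-1` [set 0]) by exact: measurable_funPTI.
have Pz : P (a @^-1` [set 0]) = 0%E.
  have := ha (measurable_set1 0); rewrite /distribution /pushforward => ->.
  have /null_content_dominatesP := @normal_prob_dominates R 0 sigma.
  by apply; [exact: measurable_set1 | exact: lebesgue_measure_set1].
have : P (~` (a @^-1` [set 0])) = 0%E.
  apply/negligibleP; first exact: measurableC.
  apply: negligibleS a0 => w /= wz /(_ I) => -[] /eqP.
  by rewrite sqrf_eq0 => /eqP.
rewrite probability_setC// Pz sube0 => /eqP.
by rewrite onee_eq0.
Qed.

End noise.

(** * Moments of a stationary contraction *)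

Section same_law.
Context d (T : measurableType d) (R : realType) (P : probability T R).

Definition same_law (X Y : T -> R) := forall A : set R, measurable A ->
  P (X @^-1` A) = P (Y @^-1` A).

Lemma same_law_comp (X Y : T -> R) (f : R -> R) : measurable_fun setT f ->
  same_law X Y -> same_law (fun w => f (X w)) (fun w => f (Y w)).
Proof.
move=> mf XY A mA; have := XY (f @^-1` A); apply.
by rewrite -[X in measurable X]setTI; exact: mf.
Qed.

Lemma same_law_mean (X Y : T -> R) :
  P.-integrable setT (EFin \o X) -> P.-integrable setT (EFin \o Y) ->
  same_law X Y -> mean P X = mean P Y.
Proof.
move=> iX iY XY.
have mX : measurable_fun setT X by apply/measurable_EFinP; exact: measurable_int iX.
have mY : measurable_fun setT Y by apply/measurable_EFinP; exact: measurable_int iY.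
pose X' : {RV P >-> R} := HB.pack X (isMeasurableFun.Build _ _ _ _ _ mX).
pose Y' : {RV P >-> R} := HB.pack Y (isMeasurableFun.Build _ _ _ _ _ mY).
have mid : measurable_fun setT (fun b : R => b%:E) by exact/measurable_EFinP.
rewrite /mean /Rintegral -(integral_distribution (X := X') mid iX).
rewrite -(integral_distribution (X := Y') mid iY); congr fine.
by apply: eq_measure_integral => A mA _; exact: XY.
Qed.

(** [min(x, K) - min(t x, K)] serves as a truncation of [(1 - t) x]: non-negative, bounded,
    nondecreasing in [K] and exact once [K >= x]. *)
Lemma min_diff_bounds (t x K : R) : 0 <= t < 1 -> 0 <= x -> 0 <= K ->
  0 <= Num.min x K - Num.min (t * x) K <= K.
Proof.
move=> /andP[t0 t1] x0 K0; have tx0 : 0 <= t * x by rewrite mulr_ge0.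
have tx : t * x <= x by rewrite ler_piMl// ltW.
by rewrite !minEle; case: (leP x K) => ?; case: (leP (t * x) K) => ?; apply/andP; split; lra.
Qed.

Lemma min_diff_homo (t x K L : R) : 0 <= t < 1 -> 0 <= x -> K <= L ->
  Num.min x K - Num.min (t * x) K <= Num.min x L - Num.min (t * x) L.
Proof.
move=> /andP[t0 t1] x0 KL.
have tx : t * x <= x by rewrite ler_piMl// ltW.
rewrite !minEle.
by case: (leP x K) => ?; case: (leP (t * x) K) => ?; case: (leP x L) => ?;
  case: (leP (t * x) L) => ?; lra.
Qed.

Lemma min_diff_eq (t x K : R) : 0 <= t < 1 -> 0 <= x -> x <= K ->
  Num.min x K - Num.min (t * x) K = (1 - t) * x.
Proof.
move=> /andP[t0 t1] x0 xK.
have tx : t * x <= x by rewrite ler_piMl// ltW.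
by rewrite !min_l//; [ring | exact: le_trans xK].
Qed.

Lemma min_drift (t x y K : R) u : 0 <= y -> u <= t * x + y ->
  Num.min u K <= Num.min (t * x) K + y.
Proof. by move=> y0 h; rewrite !minEle; case: (leP u K) => ?; case: (leP (t * x) K) => ?; lra. Qed.

(* Equality in law makes the means of [min(X, K)] and [min(X', K)] cancel; what is left as
   [K] grows is [(1 - t) E X <= E Y]. *)
Lemma drift_integrable (t : R) (X X' Y : T -> R) : 0 <= t < 1 ->
  measurable_fun setT X -> measurable_fun setT X' ->
  (forall w, 0 <= X w) -> (forall w, 0 <= X' w) -> (forall w, 0 <= Y w) ->
  P.-integrable setT (EFin \o Y) -> same_law X X' ->
  (forall w, X' w <= t * X w + Y w) -> P.-integrable setT (EFin \o X).
Proof.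
move=> t01 mX mX' X0 X'0 Y0 iY XX' drift.
have [t0 t1] := andP t01.
pose g (n : nat) w := Num.min (X w) n%:R - Num.min (t * X w) n%:R.
have mtX : measurable_fun setT (fun w => t * X w) by exact: measurable_funM.
have mmin (Z : T -> R) (n : nat) : measurable_fun setT Z ->
    measurable_fun setT (fun w => Num.min (Z w) (n%:R : R)).
  by move=> mZ; exact: measurable_minr.
have bnd (Z : T -> R) (n : nat) : measurable_fun setT Z -> (forall w, 0 <= Z w) ->
    P.-integrable setT (EFin \o (fun w => Num.min (Z w) (n%:R : R))).
  move=> mZ Z0; apply: (@integrable_dominated _ _ _ _ _ (fun=> n%:R)).
  - exact: mmin.
  - exact: fmom_integrable (fmom_cst P n%:R).
  - by move=> w; rewrite ger0_norm ?le_min ?Z0//= ge_min lexx orbT.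
have mg n : measurable_fun setT (g n) by apply: measurable_funB; exact: mmin.
have g0 n w : 0 <= g n w.
  by have /andP[] := min_diff_bounds t01 (X0 w) (ler0n R n).
have itX n : P.-integrable setT (EFin \o (fun w => Num.min (t * X w) n%:R)).
  by apply: bnd => // w; exact: mulr_ge0.
have gY n : (\int[P]_w (g n w)%:E <= \int[P]_w (Y w)%:E)%E.
  rewrite /g integralB_EFin//; last exact: bnd.
  rewrite leeBlDr; last by apply: integrable_fin_num => //; exact: itX.
  (* Equality in law is applied to bounded truncations, whose means are finite before [X] is known
     to be integrable. *)
  have -> : (\int[P]_w (Num.min (X w) n%:R)%:E =
      \int[P]_w (Num.min (X' w) n%:R)%:E)%E.
    have mn : measurable_fun setT (fun r : R => Num.min r (n%:R : R)).
      exact: measurable_minr.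
    have := same_law_mean (bnd _ n mX X0) (bnd _ n mX' X'0) (same_law_comp mn XX').
    rewrite /mean /Rintegral => h.
    rewrite -[LHS]fineK; last by apply: integrable_fin_num => //; exact: bnd.
    rewrite -[RHS]fineK; last by apply: integrable_fin_num => //; exact: bnd.
    by rewrite h.
  rewrite addeC -(integralD_EFin measurableT (itX n) iY).
  apply: le_integral => //; first exact: bnd.
    by apply: integrableD => //; exact: itX.
  by move=> w _; rewrite lee_fin min_drift.
have cvgX : (\int[P]_w (g n w)%:E @[n --> \oo] --> \int[P]_w ((1 - t) * X w)%:E)%E.
  have h w : setT w -> (((1 - t) * X w)%:E = limn (fun n => (g n w)%:E))%E.
    move=> _; apply/esym/cvg_lim => //; apply: cvg_near_cst.
    near=> n; congr EFin; apply: min_diff_eq => //.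
    by near: n; exact: nbhs_infty_ger.
  under [X in _ --> X]eq_integral do rewrite h//.
  apply: cvg_monotone_convergence => //.
  - by move=> n; exact/measurable_EFinP.
  - by move=> n w _; rewrite lee_fin.
  - by move=> w _ m n mn; rewrite lee_fin min_diff_homo// ler_nat.
have Xle : (\int[P]_w ((1 - t) * X w)%:E <= \int[P]_w (Y w)%:E)%E.
  rewrite -(cvg_lim _ cvgX)//; apply: lime_le; first by apply/cvg_ex; eexists; exact: cvgX.
  by near=> n; exact: gY.
have i1 : P.-integrable setT (fun w => ((1 - t) * X w)%:E).
  apply/integrableP; split; first by apply/measurable_EFinP; exact: measurable_funM.
  have p0 w : 0 <= (1 - t) * X w by rewrite mulr_ge0// subr_ge0 ltW.
  under eq_integral do rewrite gee0_abs ?lee_fin//.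
  rewrite (le_lt_trans Xle)// -ge0_fin_numE; first exact: integrable_fin_num.
  by apply: integral_ge0 => w _; rewrite lee_fin.
have := integrableZl measurableT ((1 - t)^-1) i1.
apply: eq_integrable => // w _ /=.
by rewrite -EFinM mulKf// subr_eq0 gt_eqF.
Unshelve. all: by end_near. Qed.

(** Convexity of the square, with [t a + b] read as the barycentre of [a] and [b / (1 - t)]; the
    contraction factor [t] is unchanged. *)
Lemma sqr_drift (t a b u : R) : 0 <= t < 1 -> 0 <= a -> 0 <= b -> 0 <= u ->
  u <= t * a + b -> u ^+ 2 <= t * a ^+ 2 + b ^+ 2 / (1 - t).
Proof.
move=> /andP[t0 t1] a0 b0 u0 h; have t10 : 0 < 1 - t by rewrite subr_gt0.
apply: (@le_trans _ _ ((t * a + b) ^+ 2)).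
  by rewrite lerXn2r// nnegrE// addr_ge0// mulr_ge0.
rewrite -subr_ge0.
rewrite (_ : _ - _ = t / (1 - t) * ((1 - t) * a - b) ^+ 2); last first.
  by field; rewrite gt_eqF.
by apply: mulr_ge0; [rewrite divr_ge0// ltW | exact: sqr_ge0].
Qed.

(** Iterating [sqr_drift] gives a drift inequality with the same [t] for the powers [2^k], to which
    [drift_integrable] applies; [p < 2^p] reaches the other powers. *)
Lemma drift_fmom (t : R) (X X' Y : T -> R) : 0 <= t < 1 ->
  measurable_fun setT X -> measurable_fun setT X' -> fmom P Y ->
  (forall w, 0 <= X w) -> (forall w, 0 <= X' w) -> (forall w, 0 <= Y w) ->
  same_law X X' -> (forall w, X' w <= t * X w + Y w) -> fmom P X.
Proof.
move=> t01 mX mX' fY X0 X'0 Y0 XX' drift.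
have pw k : exists Z, [/\ fmom P Z, forall w, 0 <= Z w &
    forall w, X' w ^+ (2 ^ k) <= t * X w ^+ (2 ^ k) + Z w].
  elim: k => [|k [Z [fZ Z0 hZ]]]; first by exists Y; split.
  exists (fun w => Z w ^+ 2 / (1 - t)); split.
  - rewrite (_ : (fun w => _) = fun w => (1 - t)^-1 * Z w ^+ 2); first by fmom_tac.
    by apply/funext => w; rewrite mulrC.
  - by move=> w; rewrite divr_ge0 ?sqr_ge0// subr_ge0 ltW//; case/andP: t01.
  - move=> w; rewrite expnS mulnC !exprM; apply: sqr_drift => //;
    exact: exprn_ge0.
have i2 k : P.-integrable setT (EFin \o (fun w => X w ^+ (2 ^ k))).
  have [Z [fZ Z0 hZ]] := pw k.
  apply: (drift_integrable t01 _ _ _ _ Z0 (fmom_integrable fZ) _ hZ).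
  - exact: measurable_funX.
  - exact: measurable_funX.
  - by move=> w; exact: exprn_ge0.
  - by move=> w; exact: exprn_ge0.
  - by apply: (same_law_comp (f := fun r => r ^+ (2 ^ k))) => //; exact: measurable_funX.
move=> p; apply: (@integrable_dominated _ _ _ _ _ (fun w => 1 + X w ^+ (2 ^ p))).
- exact: measurable_funX.
- have := integrableD measurableT (fmom_integrable (fmom_cst P 1)) (i2 p).
  by apply: eq_integrable.
- move=> w; rewrite ger0_norm ?exprn_ge0//.
  have [x1|x1] := leP (X w) 1.
    by rewrite (le_trans (exprn_ile1 _ (X0 w) x1))// lerDl exprn_ge0.
  apply: (@le_trans _ _ (X w ^+ (2 ^ p))); last by rewrite lerDr.
  by apply: ler_weXn2l; [exact: ltW | exact/ltnW/ltn_expl].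
Qed.

End same_law.

(** * The stationary AR(1) process *)

Section stationary_AR1_moments.
Context d (T : measurableType d) (R : realType) (P : probability T R).
Context (rho mu sigma : R) (z a : int -> {RV P >-> R}).
Context (hrho : `|rho| < 1) (sigma0 : sigma != 0).
Context (hz : stationary_AR1 rho mu sigma z a).

(* Shifted index: [centered i] comes from the observation [i + 1]. *)
Definition centered (i : nat) : T -> R := fun w => z i.+1%:Z w - mu.

Local Notation x := centered.
Local Notation e := (innov rho x).

Let ha t : forall A : set R, measurable A ->
  distribution P (a t) A = normal_prob 0 sigma A.
Proof. by case: (AR1_noise hz) => _; apply. Qed.

Let a_law t s : same_law P (a t) (a s).
Proof.
move=> A mA; rewrite -[LHS]/(distribution P (a t) A).
by rewrite -[RHS]/(distribution P (a s) A) !ha.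
Qed.

Let a_fmom t : fmom P (a t).
Proof. exact: (fmom_normal sigma0 (@ha t)). Qed.

Let measurable_x i : measurable_fun setT (x i).
Proof. exact: measurable_funB. Qed.

Let measurable_e i : measurable_fun setT (e i).
Proof. by apply: measurable_funB => //; exact: measurable_funM. Qed.

(** [x i] sits at time [i + 1], so the passage to [x i.+1] is driven by the noise at time
    [i + 2]. *)
Let e_ae i : {ae P, forall w, e i w = a i.+2%:Z w}.
Proof.
apply: filterS (AR1_equation hz i.+2%:Z) => w.
rewrite (_ : i.+2%:Z - 1 = i.+1%:Z); last by rewrite -[i.+2]addn1 PoszD addrK.
by rewrite /innov /centered => ->; ring.
Qed.

Lemma fmom_ae (f g : T -> R) : measurable_fun setT f -> fmom P g ->
  {ae P, forall w, f w = g w} -> fmom P f.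
Proof.
move=> mf fg fgw; apply: fmom_even => // p.
rewrite (_ : (\int[P]_w _ = \int[P]_w (g w ^+ (2 * p))%:E)%E); last first.
  apply: ae_eq_integral => //.
  - by apply/measurable_EFinP; exact: measurable_funX.
  - exact: measurable_int (fg _).
  - by apply: filterS fgw => w ->.
rewrite -ge0_fin_numE; first by apply: integrable_fin_num => //; exact: fg.
by apply: integral_ge0 => w _; rewrite lee_fin exprM exprn_ge0 ?sqr_ge0.
Qed.

Let e_fmom i : fmom P (e i).
Proof. exact: fmom_ae (a_fmom _) (e_ae i). Qed.

Let z_law t s : same_law P (z t) (z s).
Proof.
move=> A mA.
have mB : measurable ((fun v : 1.-tuple R => tnth v ord0) @^-1` A).
  by rewrite -[X in measurable X]setTI; apply: measurable_tnth.
have := AR1_stationary hz (fun=> s) (t - s) mB.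
have pre r : random_vector z (fun _ : 'I_1 => r) @^-1`
    ((fun v : 1.-tuple R => tnth v ord0) @^-1` A) = z r @^-1` A.
  by apply/seteqP; split => w; rewrite /= tnth_mktuple.
by rewrite !pre subrKC.
Qed.

Let x_law i j : same_law P (x i) (x j).
Proof.
apply: (same_law_comp (f := fun r => r - mu)); last exact: z_law.
exact: measurable_funB.
Qed.

(** No moment of [z] is given: finiteness follows from [|x_(i+1)| <= |rho| |x_i| + |e_i|], where
    both [x] terms have the same law. *)
Let x_fmom i : fmom P (x i).
Proof.
have mnx j : measurable_fun setT (fun w => `|x j w|).
  exact: measurableT_comp.
have := @drift_fmom _ _ _ P `|rho| (fun w => `|x i w|) (fun w => `|x i.+1 w|)
  (fun w => `|e i w|).
have t01 : 0 <= `|rho| < 1 by rewrite normr_ge0.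
move=> /(_ t01 (mnx i) (mnx i.+1) (fmom_norm (e_fmom i))).
have h : fmom P (fun w => `|x i w|) -> fmom P (x i).
  by move=> f; apply: (fmom_dominated _ f).
move=> f; apply: h; apply: f => //.
- apply: (same_law_comp (f := Num.norm)) => //; exact: x_law.
- move=> w; rewrite -normrM (le_trans _ (ler_normD _ _))// /innov.
  by rewrite le_eqVlt; apply/orP; left; apply/eqP; congr (`|_|); ring.
Qed.

Let past_index i (j : 'I_i.+1) : int := j.+1%:Z.

(** Puts a polynomial in the past in the form that [independent_of_past] accepts, a measurable
    preimage under a finite vector of observations. *)
Lemma poly_pastP i Y : poly_past x i Y -> exists2 g : i.+1.-tuple R -> R,
  measurable_fun setT g & Y = g \o random_vector z (@past_index i).
Proof.
elim=> [j ji|c|f1 f2 _ [g1 m1 ->] _ [g2 m2 ->]|f1 f2 _ [g1 m1 ->] _ [g2 m2 ->]].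
- exists (fun v => tnth v (Ordinal (ji : (j < i.+1)%N)) - mu).
    by apply: measurable_funB => //; exact: measurable_tnth.
  by apply/funext => w; rewrite /= tnth_mktuple.
- by exists (fun=> c).
- by exists (fun v => g1 v + g2 v) => //; exact: measurable_funD.
- by exists (fun v => g1 v * g2 v) => //; exact: measurable_funM.
Qed.

Let a_indep i p Y : poly_past x i Y -> fmom P Y ->
  mean P (fun w => a i.+2%:Z w ^+ p * Y w) =
  mean P (fun w => a i.+2%:Z w ^+ p) * mean P Y.
Proof.
move=> /poly_pastP[g mg YE] fY; have fa := fmomX p (a_fmom i.+2%:Z).
have mX := fmom_measurable fa; have mY := fmom_measurable fY.
pose X' : {RV P >-> R} := HB.pack (fun w => a i.+2%:Z w ^+ p) (isMeasurableFun.Build _ _ _ _ _ mX).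
pose Y' : {RV P >-> R} := HB.pack Y (isMeasurableFun.Build _ _ _ _ _ mY).
apply: (@independent_meanM _ _ _ P X' Y').
- move=> A B mA mB.
  rewrite (_ : X' @^-1` A = a i.+2%:Z @^-1` ((fun r => r ^+ p) @^-1` A))//.
  rewrite (_ : Y' @^-1` B = random_vector z (@past_index i) @^-1` (g @^-1` B)); last first.
    by rewrite /= YE.
  apply: (AR1_causal hz).
  + by move=> j; rewrite /past_index ltz_nat ltnS ltn_ord.
  + rewrite -[X in measurable X]setTI.
    by have /(_ measurableT A mA) := measurable_funX p (@measurable_id _ R setT).
  + by rewrite -[X in measurable X]setTI; exact: mg.
- exact: fmom_integrable.
- exact: fmom_integrable.
- by apply: fmom_integrable; exact: fmomM.
Qed.

Let ae_mean (f g : T -> R) : fmom P f -> fmom P g ->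
  {ae P, forall w, f w = g w} -> mean P f = mean P g.
Proof. by move=> ff fg; apply: ae_eq_mean; exact: fmom_measurable. Qed.

(* The value [sigma ^ 2] is never needed, since the bias does not depend on it. *)
Definition noise_var := mean P (fun w => a 0 w ^+ 2).

Lemma noise_var_gt0 : 0 < noise_var.
Proof. exact: (mean_normal2_gt0 sigma0 (@ha 0)). Qed.

Theorem stationary_AR1_moments : AR1_moments P rho noise_var x.
Proof.
have e_pow i p : mean P (fun w => e i w ^+ p) = mean P (fun w => a i.+2%:Z w ^+ p).
  apply: ae_mean; [exact: fmomX|exact: fmomX|].
  by apply: filterS (e_ae i) => w ->.
split.
- exact: x_fmom.
- move=> i p; apply: same_law_mean; [exact: x_fmom|exact: x_fmom|].
  by apply: (same_law_comp (f := fun r => r ^+ p)); [exact: measurable_funX|exact: x_law].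
- by move=> i; rewrite (e_pow i 1); exact: (mean_normal sigma0 (@ha _)).
- move=> i; rewrite e_pow; apply: same_law_mean; [exact: a_fmom|exact: a_fmom|].
  by apply: (same_law_comp (f := fun r => r ^+ 2)); [exact: measurable_funX|exact: a_law].
- move=> i p Y Yp fY; rewrite e_pow -a_indep//.
  apply: ae_mean; [apply: fmomM => //; exact: fmomX|apply: fmomM => //; exact: fmomX|].
  by apply: filterS (e_ae i) => w ->.
Qed.

End stationary_AR1_moments.

(** * The effect of the sample mean *)

Section mean_correction.
Context d (T : measurableType d) (R : realType) (P : probability T R).
Context (rho s2 : R) (x : nat -> T -> R).
Context (hrho : `|rho| < 1) (s2_gt0 : 0 < s2) (hx : AR1_moments P rho s2 x).

Local Notation E := (mean P).
Local Notation A := (psum (innov rho x)).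
Local Notation one := (fun _ : nat => 1 : R).

Definition total N : T -> R := psum x N.+1.

(* What subtracting the sample mean adds to [sum_sqr] as well as to [sum_prod]; the sample
   [x 0, ..., x N] has size [N + 1]. *)
Definition correction N : T -> R := fun w =>
  - 2 * total N w ^+ 2 / N.+1%:R - 2 * total N w ^+ 2 / N.+1%:R ^+ 2
  + 2 * total N w * (x 0 w + x N w) / N.+1%:R.

(** Summing the recursion reduces the total to the martingale [A] up to two endpoints. *)
Lemma total_eq N w : (1 - rho) * total N w = A N w + (x 0 w - rho * x N w).
Proof.
rewrite /total; elim: N => [|N IH]; first by rewrite !psumS !psum0; ring.
by rewrite psumS mulrDr IH psumS /innov; ring.
Qed.

(** Interior observations occur twice and the endpoints once, whence [2 * total - x 0 - x N]. The
    sum of products below is shifted by the same amount. *)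
Lemma center_sum_sqr N w c :
  \sum_(i < N) ((x i.+1 w - c) ^+ 2 + (x i w - c) ^+ 2) =
  sum_sqr x N w - 2 * c * (2 * total N w - x 0 w - x N w) + 2 * N%:R * c ^+ 2.
Proof.
rewrite /sum_sqr /total; elim: N => [|N IH].
  by rewrite !big_ord0 psumS psum0; ring.
rewrite !big_ord_recr /= IH [in RHS]psumS -natr1.
by set s := \sum_(i < N) _; ring.
Qed.

Lemma center_sum_prod N w c :
  2 * \sum_(i < N) (x i.+1 w - c) * (x i w - c) =
  sum_prod x N w - 2 * c * (2 * total N w - x 0 w - x N w) + 2 * N%:R * c ^+ 2.
Proof.
rewrite /sum_prod /total; elim: N => [|N IH].
  by rewrite !big_ord0 psumS psum0; ring.
rewrite !big_ord_recr /= mulrDr IH [in RHS]psumS -natr1.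
by set s := \sum_(i < N) _; ring.
Qed.

Lemma correction_eq N w : let c := total N w / N.+1%:R in
  - 2 * c * (2 * total N w - x 0 w - x N w) + 2 * N%:R * c ^+ 2 = correction N w.
Proof.
rewrite /correction /=; have n0 : N.+1%:R != 0 :> R by rewrite pnatr_eq0.
have -> : N%:R = N.+1%:R - 1 :> R by rewrite -natr1 addrK.
by field.
Qed.

Lemma fmom_total N : fmom P (total N).
Proof. by apply: fmom_psum; exact: fmom_x hx. Qed.

Lemma fmom_correction N : fmom P (correction N).
Proof.
have tf := fmom_total N; have x0 := fmom_x hx 0; have xN := fmom_x hx N.
by rewrite /correction; fmom_tac.
Qed.

Lemma O4_endpoint : O4 P one (fun N w => x 0 w - rho * x N w).
Proof.
apply: O4D; first by apply: O4_stat; exact: fmom_x hx 0.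
by apply: O4N; apply: O4Z; exact: O4_x hx.
Qed.

Lemma O4_total : O4 P rt total.
Proof.
have -> : total = fun N w => (1 - rho)^-1 * (A N w + (x 0 w - rho * x N w)).
  apply/funext => N; apply/funext => w.
  by rewrite -total_eq mulKf// gt_eqF// subr_rho_gt0.
by apply: O4Z; apply: O4D; [exact: O4_A hx|exact: O4_one_rt O4_endpoint].
Qed.

Lemma O4_total2 : O4 P (fun N => N%:R) (fun N w => total N w ^+ 2).
Proof.
pose c := 2 / (1 - rho) ^+ 2.
have rho0 : 0 < 1 - rho by exact: subr_rho_gt0.
have c0 : 0 <= c by rewrite divr_ge0// exprn_ge0 ?ltW.
have end2 : O4 P one (fun N w => (x 0 w - rho * x N w) ^+ 2).

  apply: (@O4_le _ _ _ _ _ (fun N w => 2 * x 0 w ^+ 2 + 2 * rho ^+ 2 * x N w ^+ 2)).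
  - by move=> N; have := fmom_x hx 0; have := fmom_x hx N => ? ?; fmom_tac.
  - move=> N _ w; rewrite ger0_norm ?sqr_ge0//.
    apply: le_trans (ler_norm _).
    by have := sqr_ge0 (x 0 w + rho * x N w); lra.
  - apply: O4D; last by apply: O4Z; exact: O4_x2 hx.
    by apply: O4_stat; have := fmom_x hx 0 => ?; fmom_tac.
apply: (@O4_le _ _ _ _ _
  (fun N w => c * (A N w ^+ 2 + (x 0 w - rho * x N w) ^+ 2))).
- by move=> N; have := fmom_total N => ?; fmom_tac.
- move=> N _ w; rewrite ger0_norm ?sqr_ge0//.
  apply: le_trans (ler_norm _).
  rewrite /c mulrAC ler_pdivlMr ?exprn_gt0// -exprMn mulrC total_eq.
  by have := sqr_ge0 (A N w - (x 0 w - rho * x N w)); lra.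
- apply: O4Z; apply: O4D; first exact: O4_A2 hx.
  by apply: O4_mono end2 => N N0; rewrite ler01 ler1n.
Qed.

Lemma O4_correction : O4 P one correction.
Proof.
pose b N w := x 0 w + x N w.
have ob2 : O4 P one (fun N w => b N w ^+ 2).
  apply: (@O4_le _ _ _ _ _ (fun N w => 2 * x 0 w ^+ 2 + 2 * x N w ^+ 2)).
  - by move=> N; have := fmom_x hx 0; have := fmom_x hx N => ? ?; rewrite /b; fmom_tac.
  - move=> N _ w; rewrite ger0_norm ?sqr_ge0// /b.
    apply: le_trans (ler_norm _).
    by have := sqr_ge0 (x 0 w - x N w); lra.
  - apply: O4D; last by apply: O4Z; exact: O4_x2 hx.
    by apply: O4_stat; have := fmom_x hx 0 => ?; fmom_tac.
(* The factor 5 is [2 + 2 + 1]: the two terms in [total ^ 2], and [2 |t y| <= t^2 + y^2]. *)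
apply: (@O4_le _ _ _ _ _ (fun N w => N%:R^-1 * (5 * total N w ^+ 2 + b N w ^+ 2))).
- exact: fmom_correction.
- move=> N N0 w.
  set t := total N w; set y := b N w.
  have N0' : 0 < N%:R :> R by rewrite ltr0n.
  pose n : R := N.+1%:R; have n0 : 0 < n by [].
  have n1 : n^-1 <= 1 by rewrite invf_le1// ler1n.
  have ni0 : 0 < n^-1 by rewrite invr_gt0.
  have q0 : 0 <= 5 * t ^+ 2 + y ^+ 2 by move: (sqr_ge0 t) (sqr_ge0 y); lra.
  rewrite [X in _ <= X]ger0_norm; last by rewrite mulr_ge0// invr_ge0 ltW.
  apply: (@le_trans _ _ (n^-1 * (5 * t ^+ 2 + y ^+ 2))); last first.
    by rewrite ler_wpM2r// lef_pV2 ?posrE// ler_nat.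
  rewrite (_ : correction N w =
    n^-1 * (2 * t * y - 2 * t ^+ 2 - n^-1 * (2 * t ^+ 2))); last first.
    by rewrite /correction /y /b -/t -/n; field; rewrite gt_eqF.
  rewrite normrM gtr0_norm// ler_pM2l// ler_norml.
  have t0 : 0 <= 2 * t ^+ 2 by move: (sqr_ge0 t); lra.
  have h1 : 0 <= n^-1 * (2 * t ^+ 2) by apply: mulr_ge0 => //; exact: ltW.
  have h2 : n^-1 * (2 * t ^+ 2) <= 2 * t ^+ 2 by exact: ler_piMl.
  have h3 := sqr_ge0 (t - y); have h4 := sqr_ge0 (t + y); have h5 := sqr_ge0 t.
  move: (n^-1 * _) h1 h2 => dl h1 h2; clearbody t y.
  by apply/andP; split; lra.
- apply: (@O4_scale _ _ _ _ _ (fun N => N%:R)); first by move=> N; rewrite ltr0n.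
  under eq_fun do rewrite mulr1.
  apply: O4D; first by apply: O4Z; exact: O4_total2.
  by apply: O4_mono ob2 => N N0; rewrite ler01 ler1n.
Qed.

(** The constant [s2 / (1 - rho)^2] is the long-run variance, the limit of [E total^2 / N]; the
    other terms of the correction have vanishing mean. *)
Lemma mean_correction : exists C, forall N, (0 < N)%N ->
  `|E (correction N) - - 2 * (s2 / (1 - rho) ^+ 2)| <= C / rt N.
Proof.
pose beta N w := x 0 w - rho * x N w.
pose h N w := 2 * A N w + beta N w.
pose b N w := x 0 w + x N w.
have ob : O4 P one b.
  by apply: O4D; [apply: O4_stat; exact: fmom_x hx 0|exact: O4_x hx].
have obeta : O4 P one beta by exact: O4_endpoint.
have oh : O4 P rt h.
  by apply: O4D; [apply: O4Z; exact: O4_A hx|exact: O4_one_rt].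
have one0 N : (0 < N)%N -> 0 < one N by [].
have rt0 N : (0 < N)%N -> 0 < rt N :> R by exact: rt_gt0.
have [C1 hC1] := O4_mean_prod one0 rt0 obeta oh.
have [C2 hC2] := O4_mean_prod rt0 one0 O4_total ob.
pose q := (1 - rho) ^+ 2.
have q0 : 0 < q by rewrite exprn_gt0// subr_rho_gt0.
pose sg := s2 / q.
exists (2 * sg + 4 * (C1 / q) + 2 * C2) => N N0.
have {}hC1 := hC1 _ N0; have {}hC2 := hC2 _ N0.
have tf := fmom_total N; have x0 := fmom_x hx 0; have xN := fmom_x hx N.
have Af := fmom_A hx N; have bf : fmom P (b N) by case: ob.
have betaf : fmom P (beta N) by case: obeta.
have hf : fmom P (h N) by case: oh.
(* [(A + beta)^2 = A^2 + beta (2 A + beta)] isolates the exact main term from one of order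
   [rt N]. *)
have ET2 : E (fun w => total N w ^+ 2) =
    N%:R * sg + E (fun w => beta N w * h N w) / q.
  rewrite (_ : (fun w => _) = fun w => q^-1 * (A N w ^+ 2 + beta N w * h N w)).
    rewrite meanZ; last by fmom_tac.
    rewrite meanD ?(mean_A2 hx)/sg; [|by fmom_tac|by fmom_tac].
    by rewrite mulrDr; congr (_ + _); [ring | rewrite mulrC].
  apply/funext => w.
  rewrite (_ : A N w ^+ 2 + _ = (A N w + beta N w) ^+ 2); last by rewrite /h; ring.
  by rewrite -total_eq exprMn -/q mulKf// gt_eqF.
pose n : R := N.+1%:R; have n0 : 0 < n by [].
have EK : E (correction N) = - 2 * (n^-1 + n^-1 ^+ 2) * E (fun w => total N w ^+ 2)
    + 2 * n^-1 * E (fun w => total N w * b N w).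
  rewrite (_ : correction N = fun w => - 2 * (n^-1 + n^-1 ^+ 2) * total N w ^+ 2
    + 2 * n^-1 * (total N w * b N w)).
    by rewrite meanD ?meanZ//; fmom_tac.
  apply/funext => w; rewrite /correction /b -/n; field.
  by rewrite gt_eqF.
rewrite EK ET2.
move: hC1 hC2; rewrite mul1r mulr1.
move: (E (fun w => beta N w * h N w)) (E (fun w => total N w * b N w)) => u v hu hv.
pose s : R := rt N; rewrite -/s in hu hv *.
have s1 : 1 <= s by exact: rt_ge1.
have s0 : 0 < s by exact: rt0.
have ns : N%:R = s ^+ 2 by rewrite rt2.
have nE : n = s ^+ 2 + 1 by rewrite -ns natr1.
have ni0 : 0 < n^-1 by rewrite invr_gt0.
have ni1 : n^-1 <= 1 by rewrite invf_le1// nE lerDr sqr_ge0.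
have nis : n^-1 <= s^-1 * s^-1.
  by rewrite -invfM lef_pV2 ?posrE ?mulr_gt0// nE -expr2 lerDl.
have sg0 : 0 < sg by rewrite divr_gt0.
(* Since [(1/n + 1/n^2) (n - 1) = 1 - 1/n^2], the main terms cancel and a factor [1/n] comes out. *)
have -> : - 2 * (n^-1 + n^-1 ^+ 2) * (N%:R * sg + u / q) + 2 * n^-1 * v -
    - 2 * (s2 / (1 - rho) ^+ 2) =
    n^-1 * (2 * sg * n^-1 - 2 * (1 + n^-1) * (u / q) + 2 * v).
  rewrite -/q -/sg ns (_ : s ^+ 2 = n - 1); last by rewrite nE addrK.
  by field; rewrite !gt_eqF.
rewrite normrM gtr0_norm//.
have hu' : `|u / q| <= C1 / q * s.
  rewrite normrM normfV (gtr0_norm q0) mulrAC ler_pM2r ?invr_gt0//.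
have main : `|2 * sg * n^-1 - 2 * (1 + n^-1) * (u / q) + 2 * v| <=
    (2 * sg + 4 * (C1 / q) + 2 * C2) * s.
  apply: (le_trans (ler_normD _ _)); rewrite [X in _ <= X]mulrDl.
  apply: lerD; last by rewrite normrM ger0_norm// -mulrA ler_pM2l.
  apply: (le_trans (ler_normB _ _)); rewrite [X in _ <= X]mulrDl.
  apply: lerD.
    have sg2 : 0 < 2 * sg by exact: mulr_gt0.
    rewrite ger0_norm; last by apply: ltW; exact: mulr_gt0.
    by rewrite ler_pM2l// (le_trans ni1).
  have n2 : 0 <= 2 * (1 + n^-1) by move: (n^-1) ni0 => ? ?; lra.
  rewrite normrM ger0_norm// -mulrA; apply: ler_pM => //.
  by move: (n^-1) ni1 => ? ?; lra.
have B0 : 0 <= (2 * sg + 4 * (C1 / q) + 2 * C2) * s by apply: le_trans main.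
apply: (le_trans (ler_pM (ltW ni0) (normr_ge0 _) nis main)).
by rewrite le_eqVlt; apply/orP; left; apply/eqP; field; rewrite !gt_eqF.
Qed.

End mean_correction.

(** * The Burg estimators *)

Section burg_quotient.
Context {R : realType}.
Implicit Types (y : nat -> R).

Lemma sum_nat_shift2 N (F : nat -> R) :
  \sum_(2 <= t < N.+2) F t = \sum_(i < N) F i.+2.
Proof. by rewrite 2!big_add1 /= big_mkord. Qed.

Lemma burgE N y : burg N.+1 y =
  (2 * \sum_(i < N) y i.+2 * y i.+1) / \sum_(i < N) (y i.+2 ^+ 2 + y i.+1 ^+ 2).
Proof. by rewrite /burg !sum_nat_shift2. Qed.

Let denom_ge0 N y : 0 <= \sum_(i < N) (y i.+2 ^+ 2 + y i.+1 ^+ 2).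
Proof. by apply: sumr_ge0 => i _; rewrite addr_ge0 ?sqr_ge0. Qed.

Lemma burg_num_le N y : `|2 * \sum_(i < N) y i.+2 * y i.+1| <=
  \sum_(i < N) (y i.+2 ^+ 2 + y i.+1 ^+ 2).
Proof.
rewrite mulr_sumr (le_trans (ler_norm_sum _ _ _))// ler_sum// => i _.
have := sqr_ge0 (y i.+2 - y i.+1); have := sqr_ge0 (y i.+2 + y i.+1).
by move=> ? ?; rewrite ler_norml; apply/andP; split; lra.
Qed.

Lemma burg_le1 N y : `|burg N.+1 y| <= 1.
Proof.
rewrite burgE; have := burg_num_le N y; have := denom_ge0 N y.
set D := \sum_(i < N) _; rewrite le_eqVlt => /predU1P[<- _|D0 h].
  by rewrite invr0 mulr0 normr0 ler01.
by rewrite normrM normfV (gtr0_norm D0) ler_pdivrMr// mul1r.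
Qed.

(** This survives a zero denominator, because [burg_num_le] then makes the numerator vanish as
    well. *)
Lemma burg_mul N y : burg N.+1 y * \sum_(i < N) (y i.+2 ^+ 2 + y i.+1 ^+ 2) =
  2 * \sum_(i < N) y i.+2 * y i.+1.
Proof.
rewrite burgE; have := burg_num_le N y.
set D := \sum_(i < N) (_ + _); have [->|D0 _] := eqVneq D 0; last by rewrite divfK.
by rewrite normr_le0 => /eqP ->; rewrite !mul0r.
Qed.

End burg_quotient.

(** * Measurability and the passage from a rate to a little-o remainder *)

Section bias.
Context d (T : measurableType d) (R : realType) (P : probability T R).

(** Inversion is continuous off 0, and the point 0 is split off as a measurable set. *)
Lemma measurable_invr : measurable_fun setT (@GRing.inv R).
Proof.
have m0 : measurable [set (0 : R)] by exact: measurable_set1.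
rewrite -(setvU [set (0 : R)]); apply/measurable_funU => //.
  exact: measurableC.
split; last exact: measurable_fun_set1.
apply: open_continuous_measurable_fun.
  rewrite (_ : ~` _ = [set x : R | x != 0]); first exact: open_neq.
  by apply/seteqP; split => x /= /eqP.
by move=> x; rewrite inE /= => /eqP x0; exact: inv_continuous.
Qed.

Lemma measurable_burg n (Y : nat -> T -> R) :
  (forall t, measurable_fun setT (Y t)) ->
  measurable_fun setT (fun w => burg n (fun t => Y t w)).
Proof.
move=> mY; rewrite /burg; apply: measurable_funM.
  apply: measurable_funM => //; apply: measurable_sum => t.
  exact: measurable_funM.
apply: measurableT_comp; first exact: measurable_invr.
apply: measurable_sum => t; apply: measurable_funD; exact: measurable_funX.
Qed.

(** The rate is indexed by [N = n - 1]; replacing [c / N] by [c / n] costs [O(1/n^2)], and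
    [N^(-3/2)] is already [o(1/n)]. *)
Lemma bias_expansion_of_rate (rhohat : nat -> T -> R) (rho c : R) :
  (forall n, P.-integrable setT (EFin \o (fun w => rhohat n.+1 w - rho))) ->
  (exists C, forall N, (0 < N)%N ->
    `|mean P (fun w => rhohat N.+1 w - rho) - c / N%:R| <= C / (N%:R * rt N)) ->
  bias_expansion P rhohat rho c.
Proof.
move=> ih [C hC].
exists (fun n => mean P (fun w => rhohat n w - rho) - c / n%:R); last first.
  near=> n; have n0 : (0 < n)%N by near: n; exact: nbhs_infty_gt.
  rewrite subrKC unlock /mean /Rintegral fineK//.
  by apply: integrable_fin_num => //; rewrite -(prednK n0); exact: ih.
apply/eqoP => eps eps0.
(* Both errors carry the factor [2 u v] with [u = 1/(N + 1)] and [v = 1/rt N], so [K v <= eps]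
   suffices, that is [N >= (K / eps)^2]. *)
pose K := 2 * `|C| + 2 * `|c|.
have K0 : 0 <= K by rewrite addr_ge0// mulr_ge0.
suff bound N : (0 < N)%N -> (K / eps) ^+ 2 <= N%:R ->
    `|mean P (fun w => rhohat N.+1 w - rho) - c / N.+1%:R| <= eps * `|N.+1%:R^-1|.
  near=> n.
  have n1 : (1 < n)%N by near: n; exact: nbhs_infty_gt.
  have nK : (K / eps) ^+ 2 + 1 <= n%:R by near: n; exact: nbhs_infty_ger.
  rewrite -(prednK (ltnW n1)); apply: bound; first by rewrite -ltnS prednK// ltnW.
  by rewrite -(lerD2r 1) natr1 prednK// ltnW.
move=> N0 nK.
pose s : R := rt N.
have s1 : 1 <= s by exact: rt_ge1.
have s0 : 0 < s by exact: rt_gt0.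
have ns : N%:R = s ^+ 2 by rewrite rt2.
have Ks : K / eps <= s.
  have Ke0 : 0 <= K / eps by apply: divr_ge0 => //; exact: ltW.
  by move: nK; rewrite ns ler_pXn2r// nnegrE// ltW.
have nE : N.+1%:R = s ^+ 2 + 1 by rewrite -natr1 ns.
have h := hC _ N0; rewrite ns -/s in h.
set m := mean _ _ in h *.
pose u : R := N.+1%:R^-1; pose v : R := s^-1.
have u0 : 0 < u by rewrite invr_gt0.
have v0 : 0 < v by rewrite invr_gt0.
have v1 : v <= 1 by rewrite invf_le1.
(* This is [1/N <= 2/(N + 1)]. *)
have v2u : v ^+ 2 <= 2 * u.
  rewrite /u ler_pdivlMr// nE mulrDr mulr1 -exprMn mulVf ?gt_eqF// expr1n.
  by rewrite lerD2l exprn_ile1// ltW.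
have Kv : K * v <= eps by rewrite /v ler_pdivrMr// mulrC -ler_pdivrMr.
rewrite [X in _ <= _ * X]gtr0_norm -/u//.
apply: (@le_trans _ _ (K * v * u)); last by rewrite ler_pM2r.
have -> : m - c / N.+1%:R = (m - c / s ^+ 2) + c * (v ^+ 2 * u).
  by rewrite /u /v nE; field; rewrite -nE pnatr_eq0 (gt_eqF s0).
have uv : 0 < v ^+ 2 * u by rewrite mulr_gt0// exprn_gt0.
have hm : `|m - c / s ^+ 2| <= `|C| * (2 * u * v).
  apply: (le_trans h); apply: (@le_trans _ _ (`|C| * (v ^+ 2 * v))).
    have -> : v ^+ 2 * v = (s ^+ 2 * s)^-1 by rewrite /v invfM exprVn.
    by rewrite ler_pM2r ?ler_norm// invr_gt0 mulr_gt0// exprn_gt0.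
  by rewrite ler_wpM2l// ler_pM2r.
have hc : `|c * (v ^+ 2 * u)| <= `|c| * (2 * u * v).
  rewrite normrM (gtr0_norm uv) ler_wpM2l// expr2 -mulrA.
  have : v * u <= 2 * u by rewrite ler_pM2r//; lra.
  by move=> ?; rewrite [2 * u * v]mulrC ler_pM2l.
apply: (le_trans (ler_normD _ _)); apply: (le_trans (lerD hm hc)).
by rewrite le_eqVlt; apply/orP; left; apply/eqP; rewrite /K; ring.
Unshelve. all: by end_near. Qed.

End bias.

(** * Bias of the two estimators *)

Section AR1_burg_bias.
Context d (T : measurableType d) (R : realType) (P : probability T R).
Context (rho mu sigma : R) (z a : int -> {RV P >-> R}).
Context (hrho : `|rho| < 1) (sigma0 : sigma != 0).
Context (hz : stationary_AR1 rho mu sigma z a).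

Local Notation x := (centered mu z).
Local Notation v := (ar_var rho (noise_var a)).

(** [Y N] is the sample of size [N + 1]; it depends on [N] because the sample mean changes with the
    size. *)
Lemma burg_bias_expansion (Y : nat -> nat -> T -> R) (kappa : nat -> T -> R) (k0 : R) :
  (forall N t, measurable_fun setT (Y N t)) ->
  O4 P (fun=> 1) kappa ->
  (exists C, forall N, (0 < N)%N -> `|mean P (kappa N) - k0| <= C / rt N) ->
  (forall N w, \sum_(i < N) (Y N i.+2 w ^+ 2 + Y N i.+1 w ^+ 2) =
    sum_sqr x N w + kappa N w) ->
  (forall N w, 2 * \sum_(i < N) Y N i.+2 w * Y N i.+1 w =
    sum_prod x N w + kappa N w) ->
  bias_expansion P (fun n w => burg n (fun t => Y n.-1 t w)) rho
    ((1 - rho) * k0 / (2 * v) - 2 * rho).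
Proof.
move=> mY ko hk hD hN.
have s2 := noise_var_gt0 sigma0 hz.
have hx := stationary_AR1_moments hrho sigma0 hz.
have mr N : measurable_fun setT (fun w => burg N.+1 (fun t => Y N t w) - rho).
  by apply: measurable_funB => //; exact: measurable_burg.
have r2 N w : `|burg N.+1 (fun t => Y N t w) - rho| <= 2.
  rewrite (le_trans (ler_normB _ _))// -[2]/(1 + 1) lerD ?burg_le1//.
  exact: ltW.
apply: bias_expansion_of_rate.
  move=> n; apply: fmom_integrable.
  by apply: (fmom_dominated (mr n) (fmom_cst P 2)) => w; exact: r2.
apply: (bias_rate hrho s2 hx ko hk (r := fun N w => burg N.+1 (fun t => Y N t w) - rho)) => //.
move=> N w _; rewrite mulrBl -hD burg_mul hN hD; ring.
Qed.

Lemma burg_bias_zero_mean : mu = 0 ->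
  bias_expansion P (fun n w => burg n (fun t => z t%:Z w)) rho (- (2 * rho)).
Proof.
move=> mu0.
have := @burg_bias_expansion (fun _ t => z t%:Z) (fun _ _ => 0) 0.
rewrite mulr0 mul0r add0r; apply => //.
- split=> [N|]; first exact: fmom_cst.
  by exists 0 => N _; rewrite mul0r; under eq_fun do rewrite expr0n; rewrite mean_cst.
- by exists 0 => N _; rewrite mean_cst subr0 normr0 mul0r.
- move=> N w; rewrite addr0; apply: eq_bigr => i _.
  by rewrite /centered mu0 !subr0.
- move=> N w; rewrite addr0; congr (_ * _); apply: eq_bigr => i _.
  by rewrite /centered mu0 !subr0.
Qed.

Lemma sample_meanE N w :
  sample_mean N.+1 (fun t => z t%:Z w) = mu + total x N w / N.+1%:R.
Proof.
rewrite /sample_mean big_add1 /= big_mkord /total /psum /centered.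
rewrite sumrB sumr_const card_ord -[mu *+ _]mulr_natr.
by field; rewrite addrC natr1 pnatr_eq0.
Qed.

Lemma burg_bias_unknown_mean :
  bias_expansion P (fun n w => burg_unknown_mean n (fun t => z t%:Z w))
    rho (- (1 + 3 * rho)).
Proof.
have s2 := noise_var_gt0 sigma0 hz.
have hx := stationary_AR1_moments hrho sigma0 hz.
have cE N i w : z i.+1%:Z w - sample_mean N.+1 (fun t => z t%:Z w) =
    x i w - total x N w / N.+1%:R.
  by rewrite sample_meanE /centered; ring.
have := @burg_bias_expansion
  (fun N t w => z t%:Z w - sample_mean N.+1 (fun t => z t%:Z w))
  (correction x) (- 2 * (noise_var a / (1 - rho) ^+ 2)).
(* The variance cancels: [(1 - rho) * (- 2 s2 / (1 - rho)^2) / (2 s2 / (1 - rho^2)) = - (1 +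
   rho)]. *)
rewrite (_ : _ / (2 * v) - _ = - (1 + 3 * rho)); last first.
  have r0 := subr_rho_gt0 hrho; have r1 := addr_rho_gt0 hrho.
  rewrite /ar_var (_ : 1 - rho ^+ 2 = (1 - rho) * (1 + rho)); last by ring.
  by field; rewrite !gt_eqF.
(* [n.-1.+1] differs from [n] only at 0, where both quotients have empty sums. *)
have h : (fun n w => burg_unknown_mean n (fun t => z t%:Z w)) =
  (fun n w => burg n (fun t => z t%:Z w - sample_mean n.-1.+1 (fun t => z t%:Z w))).
  apply/funext => n; apply/funext => w; case: n => // .
  by rewrite /burg_unknown_mean /burg !big_geq// !mulr0 !mul0r.
rewrite h; apply.
- move=> N t; apply: measurable_funB => //; rewrite /sample_mean.
  by apply: measurable_funM => //; exact: measurable_sum.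
- exact: (O4_correction hrho hx).
- exact: (mean_correction hrho s2 hx).
- move=> N w; under eq_bigr do rewrite !cE.
  by rewrite center_sum_sqr -correction_eq; ring.
- move=> N w; under eq_bigr do rewrite !cE.
  by rewrite center_sum_prod -correction_eq; ring.
Qed.

End AR1_burg_bias.

Theorem mainTheorem3 (d : measure_display) (T : measurableType d)
    (R : realType) (P : probability T R) (rho mu sigma : R)
    (z a : int -> {RV P >-> R}) (hrho : `|rho| < 1) (hsigma : 0 < sigma ^+ 2)
    (hz : stationary_AR1 rho mu sigma z a) :
  (mu = 0 ->
   bias_expansion P (fun n w => burg n (fun t => z t%:Z w))
     rho (- (2 * rho))) /\
  bias_expansion P (fun n w => burg_unknown_mean n (fun t => z t%:Z w))
    rho (- (1 + 3 * rho)).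
Proof.
have sigma0 : sigma != 0 by rewrite -sqrf_eq0 gt_eqF.
by split; [exact: burg_bias_zero_mean hz|exact: burg_bias_unknown_mean hz].
Qed.
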